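(* Let $z=[x^T\; y^T]^T$ with $x$ taking values in $\mathbb R^n$ and $y$ in $\mathbb R^p$, and let $f\sim\mathcal N(m_z,K_z)$ be a (possibly degenerate) Gaussian density on $\mathbb R^{n+p}$ with $$m_z=\begin{bmatrix} m_x\\ m_y\end{bmatrix},\qquad K_z=\begin{bmatrix}K_x & K_{xy}\\ K_{yx} & K_y\end{bmatrix},\qquad \operatorname{rank}(K_z)=r+p,\quad r\le n,\qquad K_y>0 .$$ Let $P:=K_x-K_{xy}K_y^{-1}K_{yx}$. Let $H\in\mathbb R^{q\times n}$, with $q\le r$, have full row rank and satisfy $\mathrm{Im}(H^T)\subseteq\mathrm{Im}(P)$. Let $c$ denote the tolerance (the mismodeling budget, i.e. the radius of the ball $\mathcal B$ below), and consider the minimax problem $$(\tilde f^0,g^0)=\arg\min_{g\in\mathcal G}\max_{\tilde f\in\mathcal B}J(\tilde f,g),\qquad J(\tilde f,g)=\tfrac12 E_{\tilde f}\big[\|H(x-g(y))\|^2\big],$$ where $\mathcal B$ is the set of Gaussian densities $\tilde f\sim\mathcal N(\tilde m_z,\tilde K_z)$ with the same support as $f$ and $D(\tilde f,f)\le c$, and $\mathcal G$ is the set of estimators $g$ for which $E_{\tilde f}[\|H(x-g(y))\|^2]$ is bounded with respect to all the Gaussian densities $\tilde f\in\mathcal B$. Then: 1. The least favorable Gaussian density $\tilde f^0$ has mean vector and covariance matrix $$\tilde m_z^0=m_z=\begin{bmatrix} m_x\\ m_y\end{bmatrix},\qquad \tilde K_z^0=\begin{bmatrix}\tilde K_x & K_{xy}\\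 K_{yx} & K_y\end{bmatrix},$$ so that only the covariance of $x$ is perturbed. 2. The optimal robust estimator is the Bayes estimator $g^0(y)=G_0(y-m_y)+m_x$ with $G_0=K_{xy}K_y^{-1}$. 3. $P$ is the nominal posterior covariance matrix of $x$ given $y$, and the least favorable posterior covariance matrix $\tilde P:=\tilde K_x-K_{xy}K_y^{-1}K_{yx}$ satisfies $$\tilde P=(P^+-\lambda^{-1}H^TH)^+ ,$$ where $\lambda$ is the Lagrange multiplier of item 4. 4. There exists a unique Lagrange multiplier $\lambda>\sigma_{max}(Q)>0$ such that $c=D(\tilde f^0,f)$, where $Q:=HH^T(HP^+H^T)^{-1}HH^T$.
   Context: For a symmetric matrix $K$, $K>0$ means positive definite, $\sigma_{max}(K)$ is its largest eigenvalue, $K^+$ is the Moore–Penrose pseudo-inverse, $\det^+(K)$ is the pseudo-determinant (product of the nonzero eigenvalues), and $\mathrm{Im}(K)$ is the image. A (possibly degenerate) Gaussian density $\mathcal N(m,K)$ on $\mathbb R^{n+p}$ with $K$ symmetric positive semidefinite of rank $r+p$ is the function $$[(2\pi)^{r+p}\det{}^+(K)]^{-1/2}\exp\left[-\tfrac12 (z-m)^TK^+(z-m)\right]$$ on its support, the $(r+p)$-dimensional affine subspace $\{m+v: v\in\mathrm{Im}(K)\}$, taken with respect to Lebesgue measure on that subspace. Two Gaussian densities $f\sim\mathcal N(m_z,K_z)$ and $\tilde f\sim\mathcal N(\tilde m_z,\tilde K_z)$ have the same support $\mathcal A$ if and only if $\mathrm{Im}(\tilde K_z)=\mathrm{Im}(K_z)$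 and $\tilde m_z-m_z\in\mathrm{Im}(K_z)$. For such a pair, the Kullback–Leibler divergence is $D(\tilde f,f)=\int_{\mathcal A}\ln\left(\tilde f(z)/f(z)\right)\tilde f(z)\,dz$, which equals $$\tfrac12\left[(\tilde m_z-m_z)^TK_z^+(\tilde m_z-m_z)+\ln\det{}^+(K_z)-\ln\det{}^+(\tilde K_z)+\operatorname{tr}(K_z^+\tilde K_z)-(r+p)\right].$$ Expectations $E_{\tilde f}$ are integrals over $\mathcal A$ against $\tilde f$. Estimators are functions $g:\mathbb R^p\to\mathbb R^n$ of the observation $y$. The pair $(\tilde f^0,g^0)$ solves the minimax problem in the sense that $g^0$ minimizes $\max_{\tilde f\in\mathcal B}J(\tilde f,g)$ over $g\in\mathcal G$, and $\tilde f^0$ (the least favorable density) maximizes $J(\tilde f,g^0)$ over $\tilde f\in\mathcal B$. In item 4, $D(\tilde f^0,f)$ is regarded as a function of $\lambda$ through $\tilde P=(P^+-\lambda^{-1}H^TH)^+$. *)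

(* Defs.v *)
From HB Require Import structures.
From mathcomp Require Import all_boot all_order all_algebra.
From mathcomp Require Import all_classical all_reals all_analysis.

Set Implicit Arguments.
Unset Strict Implicit.
Unset Printing Implicit Defensive.

Import Order.TTheory GRing.Theory Num.Theory.

Local Open Scope classical_set_scope.
Local Open Scope ring_scope.

Section LinearAlgebra.
Context {R : realType}.

Definition quad N (A : 'M[R]_N) (v : 'cV[R]_N) : R := (v^T *m A *m v) 0 0.

Definition sqnorm N (v : 'cV[R]_N) : R := (v^T *m v) 0 0.

Definition psdmx N (A : 'M[R]_N) : Prop :=
  A^T = A /\ forall v : 'cV[R]_N, 0 <= quad A v.

Definition pdmx N (A : 'M[R]_N) : Prop :=
  A^T = A /\ forall v : 'cV[R]_N, v != 0 -> 0 < quad A v.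

Definition mximage m N (A : 'M[R]_(m, N)) : set 'cV[R]_m :=
  range (fun v : 'cV[R]_N => A *m v).

Definition is_mpinv m N (A : 'M[R]_(m, N)) (X : 'M[R]_(N, m)) : Prop :=
  [/\ A *m X *m A = A, X *m A *m X = X,
      (A *m X)^T = A *m X & (X *m A)^T = X *m A].

(* Moore-Penrose pseudo-inverse; the library's pinvmx only satisfies the      *)
(* first of the Penrose equations in general.                                 *)
Definition mpinv m N (A : 'M[R]_(m, N)) : 'M[R]_(N, m) :=
  xget 0 [set X | is_mpinv A X].

(* The nonzero eigenvalues are counted with their multiplicity as roots of    *)
(* the characteristic polynomial.                                             *)
Definition pdet N (A : 'M[R]_N) : R :=
  \big[*%R/1]_(a \in [set a | eigenvalue A a /\ a != 0])
     a ^+ mup a (char_poly A).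

(* Meant for symmetric matrices of positive size, for which the set of        *)
(* eigenvalues is finite and nonempty, so that the sup is a maximum.          *)
Definition sigma_max N (A : 'M[R]_N) : R := sup [set a | eigenvalue A a].

Lemma is_mpinv_uniq m N (A : 'M[R]_(m, N)) X Y :
  is_mpinv A X -> is_mpinv A Y -> X = Y.
Proof.
move=> [AXA XAX sAX sXA] [AYA YAY sAY sYA].
have AXY : A *m X = A *m Y.
  have -> : A *m X = (A *m Y) *m (A *m X) by rewrite mulmxA AYA.
  by rewrite -sAX -sAY -trmx_mul mulmxA AXA.
have XYA : X *m A = Y *m A.
  have -> : X *m A = (X *m A) *m (Y *m A) by rewrite -mulmxA [A *m _]mulmxA AYA.
  by rewrite -sXA -sYA -trmx_mul -mulmxA [A *m _]mulmxA AXA.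
by rewrite -XAX -mulmxA AXY mulmxA XYA YAY.
Qed.

Let gram_unit k N (C : 'M[R]_(k, N)) : row_free C -> C *m C^T \in unitmx.
Proof.
move=> fC; rewrite -row_free_unit -kermx_eq0; apply/eqP/row_matrixP => i.
rewrite row0; set u := row i _.
have uC : u *m (C *m C^T) = 0 by apply/sub_kermxP; rewrite /u row_sub.
have : (u *m C) *m (u *m C)^T = 0.
  by rewrite trmx_mul mulmxA -[u *m C *m _]mulmxA uC mul0mx.
move=> /matrixP/(_ 0 0); rewrite !mxE => /eqP.
rewrite psumr_eq0; last by move=> k0 _; rewrite [_^T _ _]mxE -expr2 sqr_ge0.
move=> /allP h; apply: (row_free_inj fC); rewrite mul0mx.
apply/matrixP => a j; rewrite ord1 [RHS]mxE.
have := h j (mem_index_enum j); rewrite [_^T _ _]mxE -expr2 sqrf_eq0.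
by move/eqP.
Qed.

Lemma mpinvP m N (A : 'M[R]_(m, N)) : is_mpinv A (mpinv A).
Proof.
apply: (@xgetPex _ 0 [set X | is_mpinv A X]) => /=.
have [k [B [C [AB fB fC]]]] : exists k (B : 'M[R]_(m, k)) (C : 'M[R]_(k, N)),
    [/\ A = B *m C, row_full B & row_free C].
  exists (\rank A), (col_base A), (row_base A).
  by rewrite mulmx_base col_base_full row_base_free.
have uC : C *m C^T \in unitmx by exact: gram_unit.
have uB : B^T *m B \in unitmx.
  have := @gram_unit _ _ B^T; rewrite trmxK; apply.
  by rewrite /row_free mxrank_tr; exact: fB.
pose X := C^T *m invmx (C *m C^T) *m (invmx (B^T *m B) *m B^T).
have AX : A *m X = B *m invmx (B^T *m B) *m B^T.
  by rewrite AB /X !mulmxA -[B *m C *m C^T]mulmxA -[B *m _ *m invmx _]mulmxA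
             mulmxV // mulmx1.
have XA : X *m A = C^T *m invmx (C *m C^T) *m C.
  by rewrite AB /X -!mulmxA [B^T *m (B *m C)]mulmxA
             [invmx _ *m (_ *m C)]mulmxA mulVmx // mul1mx.
have sB : (invmx (B^T *m B))^T = invmx (B^T *m B).
  by rewrite trmx_inv trmx_mul trmxK.
have sC : (invmx (C *m C^T))^T = invmx (C *m C^T).
  by rewrite trmx_inv trmx_mul trmxK.
exists X; split.
- rewrite AX [in LHS]AB !mulmxA -[B *m _ *m B^T *m B]mulmxA.
  by rewrite -[B *m invmx _ *m _]mulmxA mulVmx // mulmx1 -AB.
- rewrite XA /X !mulmxA -[_ *m C *m C^T]mulmxA.
  by rewrite -[_ *m invmx (C *m C^T) *m (C *m C^T)]mulmxA mulVmx // mulmx1.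
- by rewrite AX !trmx_mul trmxK sB mulmxA.
- by rewrite XA !trmx_mul trmxK sC mulmxA.
Qed.

End LinearAlgebra.

Local Lemma sigma_finite_prod d1 d2 (T1 : measurableType d1) (T2 : measurableType d2)
  (R : realType) (m1 : {sigma_finite_measure set T1 -> \bar R})
  (m2 : {sigma_finite_measure set T2 -> \bar R}) :
  sigma_finite setT (m1 \x m2)%E.
Proof.
have /sigma_finiteP[F [TF ndF Foo]] := sigma_finiteT m1.
have /sigma_finiteP[G [TG ndG Goo]] := sigma_finiteT m2.
exists (fun k => F k `*` G k).
  rewrite -setXTT TF TG predeqE => -[x y]; split.
    move=> [/= [j _ Fjx] [k _ Gky]]; exists (maxn j k) => //; split.
    - by move: x Fjx; exact/subsetPset/ndF/leq_maxl.
    - by move: y Gky; exact/subsetPset/ndG/leq_maxr.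
  by move=> [j _ []/= ? ?]; split; exists j.
move=> k; have [? ?] := Foo k; have [? ?] := Goo k.
split; first exact: measurableX.
by rewrite product_measure1E// lte_mul_pinfty// ge0_fin_numE.
Qed.

Section Lebesgue.
Context {R : realType}.
Notation rV d := (d.-tuple (measurableTypeR R)).

Definition consp d (x : measurableTypeR R * rV d) : rV d.+1 :=
  [the d.+1.-tuple _ of x.1 :: x.2].

Let measurable_consp d : measurable_fun [set: _] (@consp d).
Proof. exact: measurable_cons. Qed.

HB.instance Definition _ d := isMeasurableFun.Build _ _ _ _ (@consp d)
  (@measurable_consp d).

Section step.
Variables (d : nat) (mu : {sigma_finite_measure set (rV d) -> \bar R}).

Definition lebesgue_step : set (rV d.+1) -> \bar R :=
  pushforward (@lebesgue_measure R \x mu)%E (@consp d).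

Let step0 : lebesgue_step set0 = 0%E.
Proof. exact: measure0. Qed.

Let step_ge0 A : (0 <= lebesgue_step A)%E.
Proof. exact: measure_ge0. Qed.

Let step_sigma_additive : semi_sigma_additive lebesgue_step.
Proof. exact: measure_semi_sigma_additive. Qed.

HB.instance Definition _ := isMeasure.Build _ _ _ lebesgue_step
  step0 step_ge0 step_sigma_additive.

Let sfin : sigma_finite setT lebesgue_step.
Proof.
have [F TF mF] := 
  sigma_finite_prod (@lebesgue_measure R) mu.
pose g (t : rV d.+1) : measurableTypeR R * rV d :=
  (thead t, [tuple of behead t]).
have gK : cancel g (@consp d) by move=> t; rewrite [RHS]tuple_eta; exact: val_inj.
have consK : cancel (@consp d) g.
  by case=> x t; congr pair; apply: val_inj.
have mg : measurable_fun setT g.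
  apply: measurable_fun_pair; first exact: measurable_tnth.
  exact: measurable_behead.
exists (fun k => g @^-1` F k).
  by rewrite -preimage_bigcup -TF preimage_setT.
move=> k; have [mFk Fk] := mF k; split.
  by rewrite -[X in measurable X]setTI; exact: mg.
rewrite /lebesgue_step /pushforward -comp_preimage.
by rewrite (_ : g \o _ = id) //; apply/funext => x /=; rewrite consK.
Qed.

HB.instance Definition _ := Measure_isSigmaFinite.Build _ _ _ lebesgue_step sfin.
End step.

(* Lebesgue measure on R^d, as an iterated product.                           *)
Fixpoint lebesgue d : {sigma_finite_measure set (rV d) -> \bar R} :=
  match d with
  | 0 => [the {sigma_finite_measure set (rV 0) -> \bar R} of \d_ [tuple]]
  | d'.+1 => [the {sigma_finite_measure set (rV d'.+1) -> \bar R} of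
               lebesgue_step (lebesgue d')]
  end.

End Lebesgue.

Section Gaussian.
Context {R : realType}.

Definition colt d (t : d.-tuple (measurableTypeR R)) : 'cV[R]_d :=
  \col_i (tnth t i : R).

(* The Borel sets of R^d are transported to column vectors along colt.        *)
Definition cV_measurable d (B : set 'cV[R]_d) : Prop :=
  measurable (@colt d @^-1` B).

Definition cV_measurable_fun p n (g : 'cV[R]_p -> 'cV[R]_n) : Prop :=
  forall i, measurable_fun setT
    (fun t : p.-tuple (measurableTypeR R) => g (colt t) i 0 : R).

(* The parameters (m, K) of a Gaussian density N(m, K); they describe an      *)
(* actual density when psdmx K.                                               *)
Record gauss N := Gauss { gmean : 'cV[R]_N ; gcov : 'M[R]_N }.

Section one_density.
Variables (N : nat) (f : gauss N).

Definition gsupp : set 'cV[R]_N :=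
  [set gmean f + v | v in mximage (gcov f)].

Definition gdens (z : 'cV[R]_N) : R :=
  (Num.sqrt ((2 * pi) ^+ \rank (gcov f) * pdet (gcov f)))^-1 *
  expR (- (quad (mpinv (gcov f)) (z - gmean f) / 2)).

(* Integration against Lebesgue measure on the affine subspace gsupp f: the   *)
(* subspace is parametrized by t |-> gmean f + B t, where the columns of B    *)
(* form a basis of the image of gcov f, and the Lebesgue measure of R^rank is *)
(* rescaled by the volume sqrt(det(B^T B)) of the parallelotope spanned by    *)
(* the columns of B, which makes the result independent of the basis.         *)
Definition gchart (t : (\rank (gcov f)).-tuple (measurableTypeR R)) :
    'cV[R]_N :=
  gmean f + col_base (gcov f) *m colt t.

Definition gvol : R :=
  Num.sqrt (\det ((col_base (gcov f))^T *m col_base (gcov f))).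

Definition gsupp_integral (h : 'cV[R]_N -> \bar R) : \bar R :=
  (gvol%:E * \int[lebesgue (\rank (gcov f))]_t h (gchart t))%E.

Definition gexp (h : 'cV[R]_N -> R) : \bar R :=
  gsupp_integral (fun z => (h z * gdens z)%:E).

Definition gintegrable (h : 'cV[R]_N -> R) : Prop :=
  (lebesgue (\rank (gcov f))).-integrable setT
    (fun t => (h (gchart t) * gdens (gchart t))%:E).

End one_density.

Definition same_supp_gauss N (f ft : gauss N) : Prop :=
  psdmx (gcov ft) /\ gsupp ft = gsupp f.

(* D(ft, f), meaningful when same_supp_gauss f ft.                            *)
Definition KL N (ft f : gauss N) : \bar R :=
  gsupp_integral ft (fun z => (ln (gdens ft z / gdens f z) * gdens ft z)%:E).

Definition KL_ball N (f : gauss N) (c : R) : set (gauss N) :=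
  [set ft | same_supp_gauss f ft /\ (KL ft f <= c%:E)%E].

End Gaussian.

(* In R^(n + p), the first n coordinates are x and the last p ones are y.     *)
Section Estimation.
Context {R : realType} (n p q : nat).
Implicit Types (f ft : @gauss R (n + p)) (g : 'cV[R]_p -> 'cV[R]_n).
Implicit Types (H : 'M[R]_(q, n)) (c : R).

Definition mse H ft g : \bar R :=
  gexp ft (fun z => sqnorm (H *m (usubmx z - g (dsubmx z)))).

Definition risk H ft g : \bar R := ((2^-1)%:E * mse H ft g)%E.

Definition estimators H f c : set ('cV[R]_p -> 'cV[R]_n) :=
  [set g | cV_measurable_fun g /\
     exists M : R, forall ft, KL_ball f c ft -> (mse H ft g <= M%:E)%E].

Definition worst_risk H f c g : \bar R :=
  ereal_sup [set risk H ft g | ft in KL_ball f c].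

(* (ft, g) is a solution of the minimax problem: g is a minimax estimator and *)
(* ft is least favorable for g.                                               *)
Definition minimax_solution H f c ft g : Prop :=
  [/\ estimators H f c g,
      forall g', estimators H f c g' ->
        (worst_risk H f c g <= worst_risk H f c g')%E,
      KL_ball f c ft &
      forall ft', KL_ball f c ft' -> (risk H ft' g <= risk H ft g)%E].

(* h(y) is a version of the conditional expectation of phi(x, y) given y.     *)
Definition cond_exp f (phi : 'cV[R]_(n + p) -> R) (h : 'cV[R]_p -> R) : Prop :=
  [/\ measurable_fun setT
        (fun t : p.-tuple (measurableTypeR R) => h (colt t)),
      gintegrable f phi, gintegrable f (h \o dsubmx) &
      forall B : set 'cV[R]_p, cV_measurable B ->
        gexp f (fun z => phi z * \1_B (dsubmx z)) =
        gexp f (fun z => h (dsubmx z) * \1_B (dsubmx z))].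

Definition posterior_mean f g : Prop :=
  forall i, cond_exp f (fun z => usubmx z i 0) (fun y => g y i 0).

(* Posterior covariance of x given y, when it does not depend on y.           *)
Definition posterior_cov f g (C : 'M[R]_n) : Prop :=
  posterior_mean f g /\
  forall i j, cond_exp f
    (fun z => (usubmx z - g (dsubmx z)) i 0 * (usubmx z - g (dsubmx z)) j 0)
    (fun=> C i j).

Definition bayes_estimator H f g : Prop :=
  posterior_mean f g /\
  forall g', cV_measurable_fun g' -> (risk H f g <= risk H f g')%E.

(* The Lagrangian of the maximization of the risk of g under D(ft, f) <= c.   *)
Definition lagrangian H f c g (lambda : R) ft : \bar R :=
  (risk H ft g + lambda%:E * (c%:E - KL ft f))%E.

End Estimation.

(* Main.v *)
(* Write K_z = C C^T with C of full column rank, adapted to the splitting (x, y)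
   so that y only involves the last p coordinates of the standard normal vector
   u in z = m + C u, and rotated so that S = (H C1)^T (H C1) = diag d, where
   P = C1 C1^T. The densities with the same support as f are the
   N(m + C v, C L L^T C^T) with L invertible, and for such a density
     J(., g0) = (v^T S v + tr(L^T S L)) / 2,
     D(., f) = (|v|^2 + tr(L L^T) - (r + p)) / 2 - ln |det L|.
   For lambda > max d the Lagrangian has the unique maximizer v = 0,
   L L^T = (1 - S / lambda)^-1, because ln det M <= tr M - (r + p) with equality
   only at M = 1; this is the announced density, and its divergence
   sum_i (1 / e_i - 1 + ln e_i) / 2, e_i = 1 - d_i / lambda, decreases from +oo
   to 0, which determines lambda. Estimators are compared under the least
   favorable density f0 through the symmetry u_x -> - u_x, which gives
   J(f0, g) = J(f0, g0) + E|H(g - g0)|^2 / 2, hence the saddle point; equality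
   cases give uniqueness. Everything rests on the linear change of variables in
   the iterated Lebesgue integral, proved by Gaussian elimination. *)
From HB Require Import structures.
Require Import Defs.
From mathcomp Require Import all_boot all_order all_algebra.
From mathcomp Require Import all_classical all_reals all_analysis.
From mathcomp Require Import ring lra measurable_realfun complex.
Import Order.TTheory GRing.Theory Num.Theory.
Set Implicit Arguments.
Unset Strict Implicit.
Unset Printing Implicit Defensive.
Local Open Scope classical_set_scope.
Local Open Scope ring_scope.

(** * Real symmetric matrices *)

(** The degeneracy of K_z is removed once and for all: every competitor is the image of the standard
    normal law on R^(r+p) under u -> m + C (v + L u), so that expectations stop depending on the
    basis chosen in the definitions. Making S diagonal turns the optimal L and its divergence into
    scalar functions of the d_i. The y coordinates of u have weight 0, and 1 - 0 / lambda = 1: this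
    is why the covariance of y and the gain are unchanged in the least favorable density. The
    multiplier is sought through x = 1 / lambda, because the divergence is then continuous on a
    compact interval starting at 0, where it vanishes. Two points need care. The spectrum of Q may
    lie below the largest d_i, so in the uniqueness of lambda the bound d < lambda has to come from
    the support of the candidate. And a minimax estimator g is only known to satisfy H g = H g0
    almost everywhere under f0; to identify a density that is least favorable for g, this must be
    carried over to that density, which works because all densities with the given support have the
    same null sets. *)

Section LinearAlgebraFacts.
Context {R : realType}.
Local Notation "M ^t*" := (map_mx Num.conj M^T) (at level 30).

Lemma sqnormE N (v : 'cV[R]_N) : sqnorm v = \sum_i v i 0 ^+ 2.
Proof. by rewrite /sqnorm mxE; apply: eq_bigr => i _; rewrite mxE expr2. Qed.

Lemma sqnorm_ge0 N (v : 'cV[R]_N) : 0 <= sqnorm v.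
Proof. by rewrite sqnormE sumr_ge0// => i _; rewrite sqr_ge0. Qed.

Lemma sqnorm_eq0 N (v : 'cV[R]_N) : sqnorm v = 0 -> v = 0.
Proof.
rewrite sqnormE => /eqP; rewrite psumr_eq0 => [/allP v0|i _]; last exact: sqr_ge0.
apply/colP => i; rewrite mxE; apply/eqP; rewrite -sqrf_eq0.
by apply: v0; rewrite mem_index_enum.
Qed.

Lemma sqnorm_gt0 N (v : 'cV[R]_N) : v != 0 -> 0 < sqnorm v.
Proof.
move=> v0; rewrite lt_neqAle sqnorm_ge0 andbT eq_sym.
by apply: contra v0 => /eqP/sqnorm_eq0 ->.
Qed.

Lemma sqnormZ N a (v : 'cV[R]_N) : sqnorm (a *: v) = a ^+ 2 * sqnorm v.
Proof.
by rewrite !sqnormE mulr_sumr; apply: eq_bigr => i _; rewrite mxE exprMn.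
Qed.

Lemma quad_mul N k (A : 'M[R]_N) (C : 'M[R]_(N, k)) v :
  quad A (C *m v) = quad (C^T *m A *m C) v.
Proof. by rewrite /quad trmx_mul !mulmxA. Qed.

Lemma quad_gram N k (C : 'M[R]_(k, N)) v : quad (C^T *m C) v = sqnorm (C *m v).
Proof. by rewrite /quad /sqnorm trmx_mul !mulmxA. Qed.

Lemma quad_diag N (d : 'rV[R]_N) v :
  quad (diag_mx d) v = \sum_i d 0 i * v i 0 ^+ 2.
Proof.
rewrite /quad mxE; apply: eq_bigr => i _.
by rewrite mul_mx_diag !mxE; ring.
Qed.

(** A complex eigenvalue a exists by algebraic closedness. Evaluating the Hermitian form at an
    eigenvector in two ways gives a and its conjugate times the same nonzero number, so a is real;
    it descends to R as a root of the characteristic polynomial. *)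
Lemma exists_real_eigenvalue N (A : 'M[R]_N) : (0 < N)%N -> A^T = A ->
  exists a, eigenvalue A a.
Proof.
move=> N0 sA.
pose toC := [eta @map_mx R (R[i]) (real_complex R) N N].
have [a /eigenvalueP[v vA v0]] := eigenvalue_closed (toC A) N0.
have toCT : (toC A) ^t* = toC A.
  rewrite /toC -[in RHS]sA; apply/matrixP => i j; rewrite !mxE.
  by rewrite conj_Creal//; apply/complex_realP; eexists.
have nv0 : (v *m v ^t*) 0 0 != 0.
  rewrite mxE psumr_eq0; last by move=> i _; rewrite !mxE mul_conjC_ge0.
  apply: contra v0 => /allP vi0; apply/eqP/rowP => i; rewrite mxE.
  have := vi0 i (mem_index_enum _).
  by rewrite !mxE /= mul_conjC_eq0 => /eqP.
have Ca : a^* = a.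
  have e1 : v *m toC A *m v ^t* = a *: (v *m v ^t*).
    by rewrite vA scalemxAl.
  have e2 : v *m toC A *m v ^t* = a^* *: (v *m v ^t*).
    rewrite -mulmxA -toCT.
    have -> : (toC A) ^t* *m v ^t* = (v *m toC A) ^t*.
      by rewrite trmx_mul map_mxM.
    by rewrite vA linearZ /= map_mxZ scalemxAr.
  move: e1; rewrite e2 => /matrixP/(_ 0 0).
  rewrite [LHS]mxE [RHS]mxE.
  exact: mulIf.
have /complex_realP[b ab] : a \is Num.real by rewrite CrealE Ca.
exists b; move: (vA) => _.
have : eigenvalue (toC A) a by apply/eigenvalueP; exists v.
by rewrite ab eigenvalue_root_char -map_char_poly fmorph_root -eigenvalue_root_char.
Qed.

(* The reflection through the hyperplane orthogonal to e - e_0. *)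
Lemma householder n (e : 'cV[R]_(1 + n)) : sqnorm e = 1 ->
  exists2 U : 'M[R]_(1 + n), U *m U = 1%:M /\ U^T = U & U *m delta_mx 0 0 = e.
Proof.
move=> e1; pose dl : 'cV[R]_(1 + n) := delta_mx 0 0.
have [->|ed] := eqVneq e dl.
  by exists 1%:M; rewrite ?mul1mx ?trmx1.
pose w := e - dl; have w0 : sqnorm w != 0.
  by apply: contra ed => /eqP/sqnorm_eq0/eqP; rewrite subr_eq0.
pose s := 2 / sqnorm w.
have ww : w^T *m w = (sqnorm w)%:M by rewrite [LHS]mx11_scalar.
have wd : w^T *m dl = (- (sqnorm w / 2))%:M.
  rewrite [LHS]mx11_scalar; congr (_%:M).
  have dd : (dl^T *m dl) 0 0 = 1.
    by rewrite mxE (bigD1 0)//= big1 ?addr0 ?mxE ?eqxx ?mulr1// => i i0;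
       rewrite !mxE (negbTE i0) mul0r.
  have ee : (e^T *m e) 0 0 = 1 by [].
  have de : (dl^T *m e) 0 0 = (e^T *m dl) 0 0.
    by rewrite -[in RHS](trmxK dl) -trmx_mul [RHS]mxE.
  rewrite /sqnorm /w linearB /= !(mulmxBl, mulmxBr).
  move: dd ee de; set X := _ *m dl; set Y := _ *m e.
  set Z := dl^T *m e; set T := e^T *m dl => dd ee de.
  have E : forall A B : 'M[R]_1, (A - B) 0 0 = A 0 0 - B 0 0 by move=> *; rewrite !mxE.
  rewrite !E dd ee de; lra.
exists (1%:M - s *: (w *m w^T)); last first.
  rewrite mulmxBl mul1mx -scalemxAl -mulmxA wd mul_mx_scalar scalerA.
  by rewrite /s mulrN mulrA divfK// divff// scaleN1r opprK /w addrC subrK.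
split; last by rewrite linearB /= trmx1 linearZ /= trmx_mul trmxK.
rewrite mulmxBl mul1mx mulmxBr mulmx1 -!scalemxAl -!scalemxAr.
rewrite -[w *m w^T *m _]mulmxA [w^T *m (_ *m _)]mulmxA ww mul_scalar_mx.
rewrite -scalemxAr !scalerA.
have -> : s * (s * sqnorm w) = s + s by rewrite /s; field.
by rewrite scalerDl opprB addrK subrK.
Qed.

(** Deflation: a reflection moves a unit eigenvector to the first basis vector. The first column of
    the conjugated matrix is then a multiple of that vector, by symmetry so is its first row, and
    the induction applies to the remaining block. *)
Lemma orthogonal_diag N (A : 'M[R]_N) : A^T = A ->
  exists (U : 'M[R]_N) (d : 'rV[R]_N),
    U^T *m U = 1%:M /\ A = U *m diag_mx d *m U^T.
Proof.
elim: N A => [|n IH]; first by move=> A _; exists 0, 0; split; apply/matrixP => -[].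
rewrite -[n.+1]/(1 + n)%N => A sA.
have [a /eigenvalueP[v vA v0]] := exists_real_eigenvalue (ltn0Sn n) sA.
pose e : 'cV[R]_(1 + n) := (Num.sqrt (sqnorm v^T))^-1 *: v^T.
have nv0 : 0 < sqnorm v^T.
  apply: sqnorm_gt0; apply: contra v0 => /eqP v0.
  by rewrite -[v]trmxK v0 trmx0.
have e1 : sqnorm e = 1.
  by rewrite /e sqnormZ exprVn sqr_sqrtr ?mulVf ?ltW// gt_eqF.
have Ae : (A : 'M[R]_(1 + n)) *m e = a *: e.
  rewrite /e -scalemxAr -{1}sA -trmx_mul vA linearZ /= !scalerA.
  by rewrite mulrC.
have [U [UU sU] Ud] := householder e1.
pose B : 'M[R]_(1 + n) := U *m A *m U.
have sB : B^T = B by rewrite /B !trmx_mul sU sA mulmxA.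
have Bd : B *m delta_mx 0 0 = a *: delta_mx 0 (0 : 'I_1).
  by rewrite /B -!mulmxA Ud Ae -scalemxAr -Ud mulmxA UU mul1mx.
have Bcol i : B i 0 = a *+ (i == 0).
  move: Bd => /matrixP/(_ i 0).
  by rewrite -colE !mxE eqxx andbT mulr_natr.
have AE : A = U *m B *m U^T.
  rewrite /B sU !mulmxA UU mul1mx -mulmxA UU; exact/esym/mulmx1.
clearbody B.
have BcolL i (j : 'I_1) : B i (lshift n j) = a *+ (i == 0).
  by rewrite -Bcol; congr (B _ _); apply: val_inj; rewrite ord1.
have ul : ulsubmx B = a%:M.
  by rewrite [LHS]mx11_scalar; congr _%:M; rewrite 2!mxE BcolL.
have dl : dlsubmx B = 0.
  by apply/colP => i; rewrite 3!mxE BcolL; case: eqP => // /(congr1 val).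
have ur : ursubmx B = 0.
  by rewrite -[LHS]trmxK trmx_ursub sB dl trmx0.
have [U' [d' [U'1 dr]]] := IH (drsubmx B) (etrans (trmx_drsub B) (f_equal drsubmx sB)).
pose V : 'M[R]_(1 + n) := block_mx 1%:M 0 0 U'.
exists (U *m V), (row_mx a%:M d'); split.
  rewrite trmx_mul mulmxA -[_ *m U^T *m U]mulmxA sU UU mulmx1.
  rewrite /V tr_block_mx mulmx_block !(mulmx0, mul0mx, addr0, add0r, trmx0, trmx1).
  by rewrite mulmx1 U'1 -scalar_mx_block.
have -> : diag_mx (row_mx a%:M d') = block_mx a%:M 0 0 (diag_mx d').
  rewrite diag_mx_row; congr block_mx.
  by apply/matrixP => i j; rewrite !ord1 !mxE.
rewrite AE.
rewrite trmx_mul !mulmxA; congr (_ *m U^T); rewrite -!mulmxA; congr (U *m _).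
rewrite -[LHS]submxK ul ur dl dr /V tr_block_mx !mulmx_block.
by rewrite !(mulmx0, mul0mx, addr0, add0r, trmx0, trmx1, mulmx1, mul1mx) mulmxA.
Qed.

Lemma psdmx_diag_ge0 N (d : 'rV[R]_N) : psdmx (diag_mx d) -> forall i, 0 <= d 0 i.
Proof.
move=> [_ h] i; have := h (delta_mx i 0); rewrite quad_diag (bigD1 i)//= big1.
  by rewrite !mxE !eqxx expr1n mulr1 addr0.
by move=> j ji; rewrite !mxE (negbTE ji) expr0n mulr0.
Qed.

Lemma psdmx_conj N k (A : 'M[R]_N) (C : 'M[R]_(N, k)) :
  psdmx A -> psdmx (C^T *m A *m C).
Proof.
move=> [sA pA]; split; first by rewrite !trmx_mul trmxK sA mulmxA.
by move=> v; rewrite -quad_mul.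
Qed.

Lemma psdmx_sqrt N (A : 'M[R]_N) : psdmx A -> exists L : 'M[R]_N, A = L *m L^T.
Proof.
move=> pA; have [U [d [U1 AE]]] := orthogonal_diag pA.1.
have d0 : forall i, 0 <= d 0 i.
  apply: psdmx_diag_ge0; have := psdmx_conj U pA.
  by rewrite AE !mulmxA U1 mul1mx -mulmxA U1 mulmx1.
exists (U *m diag_mx (map_mx Num.sqrt d)); rewrite trmx_mul tr_diag_mx.
rewrite mulmxA -[U *m _ *m _]mulmxA mulmx_diag AE; congr (U *m diag_mx _ *m _).
by apply/rowP => i; rewrite !mxE -expr2 sqr_sqrtr.
Qed.

End LinearAlgebraFacts.

(** * Images and pseudo-inverses *)

Section Image.
Context {R : realType}.

Lemma mximage_subP m k l (A : 'M[R]_(m, k)) (B : 'M[R]_(m, l)) :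
  mximage A `<=` mximage B <-> exists X, A = B *m X.
Proof.
split=> [AB|[X ->] _ [v _ <-]]; last by exists (X *m v) => //; rewrite mulmxA.
have /submxP[D AD] : (A^T <= B^T)%MS.
  apply/row_subP => i; have [|v _ vE] := AB (A *m delta_mx i 0); first by exists (delta_mx i 0).
  by rewrite -tr_col colE -vE trmx_mul submxMl.
by exists D^T; rewrite -[A]trmxK AD trmx_mul trmxK.
Qed.

Lemma mximage_eqP m k l (A : 'M[R]_(m, k)) (B : 'M[R]_(m, l)) :
  mximage A = mximage B <-> (exists X, A = B *m X) /\ (exists Y, B = A *m Y).
Proof.
split=> [AB|[/mximage_subP AB /mximage_subP BA]]; last exact/seteqP.
by split; apply/mximage_subP; rewrite AB.
Qed.

Lemma mximage_rank m k l (A : 'M[R]_(m, k)) (B : 'M[R]_(m, l)) :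
  mximage A = mximage B -> \rank A = \rank B.
Proof.
move=> /mximage_eqP[[X AX] [Y BY]]; apply/eqP; rewrite eqn_leq.
by apply/andP; split; [rewrite AX|rewrite BY]; exact: mxrankM_maxl.
Qed.

Lemma mximage_sub_rank m k l (A : 'M[R]_(m, k)) (B : 'M[R]_(m, l)) :
  mximage A `<=` mximage B -> \rank A = \rank B -> mximage A = mximage B.
Proof.
move=> AB rAB; apply/mximage_eqP; split; first exact/mximage_subP.
move: AB => /mximage_subP[X AX].
have /submxP[D BD] : (B^T <= A^T)%MS.
  rewrite -mxrank_leqif_sup ?mxrank_tr ?rAB//.
  by rewrite AX trmx_mul submxMl.
by exists D^T; rewrite -[B]trmxK BD trmx_mul trmxK.
Qed.

Lemma mximage_mul_unit m k (C : 'M[R]_(m, k)) (L : 'M[R]_k) :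
  L \in unitmx -> mximage (C *m L) = mximage C.
Proof.
move=> uL; apply/mximage_eqP; split; first by exists L.
by exists (invmx L); rewrite mulmxK.
Qed.

Lemma mpinvK_full N k (C : 'M[R]_(N, k)) : row_full C -> mpinv C *m C = 1%:M.
Proof.
move=> fC; have [CC _ _ _] := mpinvP C.
by apply: (row_full_inj fC); rewrite mulmxA CC mulmx1.
Qed.

Lemma mpinv_proj_sym N k (C : 'M[R]_(N, k)) : (C *m mpinv C)^T = C *m mpinv C.
Proof. by have [] := mpinvP C. Qed.

Lemma mpinv_eq m k (A : 'M[R]_(m, k)) X : is_mpinv A X -> mpinv A = X.
Proof. by move=> AX; apply: is_mpinv_uniq (mpinvP A) AX. Qed.

Lemma mpinvK m k (A : 'M[R]_(m, k)) : mpinv (mpinv A) = A.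
Proof. by apply: mpinv_eq; have [? ? ? ?] := mpinvP A; split. Qed.

(** With full column rank, [mpinv C] is a left inverse of C and [C *m mpinv C] is the orthogonal
    projector onto its image. Both products of the two matrices equal this symmetric projector,
    which gives all four Penrose equations. *)
Lemma mpinv_sandwich N k (C : 'M[R]_(N, k)) (E E' : 'M[R]_k) :
  row_full C -> E *m E' = 1%:M ->
  mpinv (C *m E *m C^T) = (mpinv C)^T *m E' *m mpinv C.
Proof.
move=> fC EE'; have E'E := mulmx1C EE'.
have dC := mpinvK_full fC; have sC := mpinv_proj_sym C.
have tC : C^T *m (mpinv C)^T = 1%:M by rewrite -trmx_mul dC trmx1.
have AX : C *m E *m C^T *m ((mpinv C)^T *m E' *m mpinv C) = C *m mpinv C.
  rewrite !mulmxA -[_ *m C^T *m _]mulmxA tC mulmx1.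
  by rewrite -[C *m E *m E']mulmxA EE' mulmx1.
have XA : (mpinv C)^T *m E' *m mpinv C *m (C *m E *m C^T) = C *m mpinv C.
  rewrite !mulmxA -[_ *m mpinv C *m C]mulmxA dC mulmx1.
  by rewrite -[_ *m E' *m E]mulmxA E'E mulmx1 -trmx_mul sC.
apply: mpinv_eq; split; rewrite ?AX ?XA//.
  by rewrite !mulmxA -[C *m _ *m C]mulmxA dC mulmx1.
by rewrite -sC trmx_mul !mulmxA -[_ *m C^T *m _]mulmxA tC mulmx1.
Qed.

Lemma mpinv_sandwichV N k (C : 'M[R]_(N, k)) (E E' : 'M[R]_k) :
  row_full C -> E *m E' = 1%:M ->
  mpinv ((mpinv C)^T *m E *m mpinv C) = C *m E' *m C^T.
Proof. by move=> fC /mulmx1C EE; rewrite -(mpinv_sandwich fC EE) mpinvK. Qed.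

Lemma row_full_mul_unit N k (C : 'M[R]_(N, k)) (L : 'M[R]_k) :
  row_full C -> L \in unitmx -> row_full (C *m L).
Proof. by move=> fC uL; rewrite /row_full mxrankMfree ?row_free_unit. Qed.

Lemma gram_unit N k (C : 'M[R]_(N, k)) : row_full C -> C^T *m C \in unitmx.
Proof.
move=> fC; have dC := mpinvK_full fC.
apply: (proj1 (mulmx1_unit (B := mpinv C *m (mpinv C)^T) _)).
rewrite mulmxA -[_ *m C *m _]mulmxA -mpinv_proj_sym trmx_mul !mulmxA -trmx_mul dC.
by rewrite trmx1 mul1mx -trmx_mul dC trmx1.
Qed.

Lemma psdmx_gram N k (C : 'M[R]_(N, k)) : psdmx (C *m C^T).
Proof.
split; first by rewrite trmx_mul trmxK.
by move=> v; rewrite -{1}[C]trmxK quad_gram sqnorm_ge0.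
Qed.

Lemma psdmx_det_gt0 N (A : 'M[R]_N) : psdmx A -> A \in unitmx -> 0 < \det A.
Proof.
move=> pA; rewrite unitmxE unitfE => A0; rewrite lt_neqAle eq_sym A0/=.
by have [L ->] := psdmx_sqrt pA; rewrite det_mulmx det_tr -expr2 sqr_ge0.
Qed.

Lemma det_gram_gt0 N k (C : 'M[R]_(N, k)) : row_full C -> 0 < \det (C^T *m C).
Proof.
by move=> fC; apply: psdmx_det_gt0; [rewrite -{2}[C]trmxK; exact: psdmx_gram|exact: gram_unit].
Qed.

Lemma mximage_gram N k (C : 'M[R]_(N, k)) : row_full C ->
  mximage (C *m C^T) = mximage C.
Proof.
move=> fC; apply/mximage_eqP; split; first by exists C^T.
by exists (mpinv C)^T; rewrite -mulmxA -trmx_mul mpinvK_full// trmx1 mulmx1.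
Qed.

(** Compressing A by the left inverse of C gives a positive semidefinite k x k matrix, and L is a
    square root of it. L is invertible because the image of C is contained in that of A. *)
Lemma psdmx_factor N k (C : 'M[R]_(N, k)) A : row_full C -> psdmx A ->
  mximage A = mximage C ->
  exists2 L : 'M[R]_k, L \in unitmx & A = C *m L *m (C *m L)^T.
Proof.
move=> fC pA /mximage_eqP[[X AX] [Y CY]].
have dC := mpinvK_full fC.
have PA : C *m mpinv C *m A = A.
  by rewrite {1}AX !mulmxA -[C *m _ *m C]mulmxA dC mulmx1 -AX.
have pM : psdmx (mpinv C *m A *m (mpinv C)^T).
  by rewrite -{1}[mpinv C]trmxK; exact: psdmx_conj.
have [L LE] := psdmx_sqrt pM.
have AE : A = C *m L *m (C *m L)^T.
  rewrite trmx_mul !mulmxA -[C *m L *m L^T]mulmxA -LE !mulmxA PA -mulmxA -trmx_mul.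
  by rewrite -[in RHS]pA.1 -trmx_mul PA pA.1.
exists L => //.
have : L *m (L^T *m C^T *m Y) = 1%:M.
  transitivity (mpinv C *m (A *m Y)); last by rewrite -CY.
  by rewrite AE trmx_mul !mulmxA dC mul1mx.
by case/mulmx1_unit.
Qed.

Lemma psdmx_rank_factor N k (A : 'M[R]_N) : psdmx A -> \rank A = k ->
  exists2 C : 'M[R]_(N, k), row_full C & A = C *m C^T.
Proof.
move=> pA <-.
have fB := col_base_full A.
have [|L uL AE] := psdmx_factor fB pA.
  apply: mximage_sub_rank; last by rewrite (eqP fB).
  by apply/mximage_subP; exists (row_base A); rewrite mulmx_base.
by exists (col_base A *m L) => //; exact: row_full_mul_unit.
Qed.

End Image.

(** * Pseudo-determinants *)

Section PseudoDet.
Context {R : realType}.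

Lemma mup_prod_XsubC (s : seq R) a :
  mup a (\prod_(x <- s) ('X - x%:P)) = count_mem a s.
Proof.
elim: s => [|x s IH]; first by rewrite big_nil mupNroot// rootC oner_eq0.
rewrite big_cons mupM ?polyXsubC_eq0//; last first.
  by rewrite prodf_seq_neq0; apply/allP => y _; rewrite polyXsubC_eq0.
by rewrite IH -['X - _]expr1 mup_XsubCX /= eq_sym; case: eqP.
Qed.

(** [pdet] runs over distinct eigenvalues with multiplicities as exponents; grouping equal roots in
    s gives the same product. *)
Lemma pdet_prod_roots N (A : 'M[R]_N) (s : seq R) :
  char_poly A = \prod_(x <- s) ('X - x%:P) ->
  pdet A = \prod_(x <- s | x != 0) x.
Proof.
move=> As; have eA : [set a | eigenvalue A a /\ a != 0] =
    [set` undup [seq x <- s | x != 0]].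
  apply/seteqP; split=> a /=;
    rewrite mem_undup mem_filter eigenvalue_root_char As root_prod_XsubC /=.
    by case=> -> ->.
  by move/andP => [-> ->].
rewrite /pdet eA -fsbig_seq ?undup_uniq//; set t := [seq _ <- _ | _].
transitivity (\prod_(a <- undup t) a ^+ count_mem a t); last first.
  have -> := prodr_undup_exp_count t xpredT id; exact: big_filter.
rewrite [LHS]big_seq [RHS]big_seq; apply: eq_bigr => a; rewrite mem_undup mem_filter => /andP[/= a0 _].
rewrite As mup_prod_XsubC; congr (_ ^+ _).
rewrite count_filter; apply: eq_count => x /=.
by case: eqP => //= ->.
Qed.

(* Sylvester's identity: both sides are determinants of products of
   [['X, C], [C^T, 1]] with a block triangular matrix. *)
Lemma char_poly_gram N k (C : 'M[R]_(N, k)) :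
  char_poly (C *m C^T) * 'X^k = char_poly (C^T *m C) * 'X^N.
Proof.
pose c := map_mx polyC C; pose ct := map_mx polyC C^T.
pose M := block_mx ('X%:M : 'M[{poly R}]_N) c ct (1%:M : 'M[{poly R}]_k).
have M1 : M *m block_mx 1%:M 0 (- ct) 1%:M =
    block_mx (char_poly_mx (C *m C^T)) c 0 1%:M.
  rewrite mulmx_block !(mulmx1, mulmx0, mul1mx, add0r) subrr.
  by rewrite /char_poly_mx map_mxM mulmxN.
have M2 : block_mx 1%:M 0 (- ct) 'X%:M *m M =
    block_mx 'X%:M c 0 (char_poly_mx (C^T *m C)).
  rewrite mulmx_block !(mulmx1, mul0mx, mulmx0, mul1mx, addr0).
  rewrite mul_mx_scalar mul_scalar_mx scalerN addNr.
  by rewrite /char_poly_mx map_mxM mulNmx addrC.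
move: (f_equal determinant M1) (f_equal determinant M2).
rewrite !det_mulmx !det_lblock !det_ublock !det1 !mul1r !mulr1 !det_scalar.
by move=> dM; rewrite dM /char_poly mulrC => ->; rewrite mulrC.
Qed.

Lemma char_poly_orthogonal N (U : 'M[R]_N) (d : 'rV[R]_N) : U^T *m U = 1%:M ->
  char_poly (U *m diag_mx d *m U^T) = \prod_i ('X - (d 0 i)%:P).
Proof.
move=> U1; have := char_poly_trig (diag_mx_is_trig d); rewrite /char_poly.
under [in RHS]eq_bigr do rewrite mxE eqxx mulr1n.
move=> <-; set u := map_mx polyC U; set ut := map_mx polyC U^T.
have uu : u *m ut = 1%:M by rewrite -map_mxM (mulmx1C U1) map_mx1.
have -> : char_poly_mx (U *m diag_mx d *m U^T) = u *m char_poly_mx (diag_mx d) *m ut.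
  rewrite /char_poly_mx !map_mxM mulmxBr mulmxBl; congr (_ - _).
  by rewrite mul_mx_scalar -scalemxAl uu scalemx1.
by rewrite !det_mulmx mulrAC -det_mulmx uu det1 mul1r.
Qed.

(** By [char_poly_gram], the spectrum of C C^T is that of the invertible matrix C^T C together with
    N - k zeros, which the pseudo-determinant discards. *)
Lemma pdet_gram N k (C : 'M[R]_(N, k)) : row_full C ->
  pdet (C *m C^T) = \det (C^T *m C).
Proof.
move=> fC; have pG : psdmx (C^T *m C) by rewrite -{2}[C]trmxK; exact: psdmx_gram.
have [U [d [U1 GE]]] := orthogonal_diag pG.1.
have detG : \det (C^T *m C) = \prod_i d 0 i.
  by rewrite GE !det_mulmx det_diag mulrAC -det_mulmx (mulmx1C U1) det1 mul1r.
have kN : (k <= N)%N by rewrite -(eqP fC) rank_leq_row.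
have cP : char_poly (C *m C^T) =
    \prod_(x <- nseq (N - k) 0 ++ [seq d 0 i | i <- enum 'I_k]) ('X - x%:P).
  have XN : 'X^N = 'X^(N - k) * 'X^k :> {poly R} by rewrite -exprD subnK.
  have := char_poly_gram C; rewrite GE char_poly_orthogonal// XN mulrA.
  move=> /(mulIf _) ->; last by rewrite expf_neq0// polyX_eq0.
  rewrite big_cat big_nseq/= subr0 big_map big_enum/= mulrC.
  by rewrite iter_mulr_1.
rewrite (pdet_prod_roots cP) big_cat big_map /= big_enum_cond /= detG.
rewrite big_nseq_cond eqxx /= mul1r; apply: eq_bigl => i.
apply/idP; apply: contraTneq (det_gram_gt0 fC) => d0.
by rewrite detG (bigD1 i)//= d0 mul0r ltxx.
Qed.

End PseudoDet.

(** * Linear changes of variables in Lebesgue integrals *)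

Section Affine1D.
Context {R : realType}.
Local Notation mu := (@lebesgue_measure R).

Definition affine (a b : R) (x : measurableTypeR R) : measurableTypeR R := a * x + b.

Lemma measurable_affine a b : measurable_fun setT (affine a b).
Proof. by apply: measurable_funD => //; exact: measurable_funM. Qed.

HB.instance Definition _ a b :=
  isMeasurableFun.Build _ _ _ _ (affine a b) (measurable_affine a b).

Lemma affine_preimage_oc (a b x y : R) : 0 < a ->
  affine a b @^-1` `]x, y]%classic = `](x - b) / a, (y - b) / a]%classic.
Proof.
move=> a0; apply/seteqP; split => t /=; rewrite !in_itv /= /affine;
  by rewrite ltr_pdivrMr// ler_pdivlMr// ltrBlDr lerBrDr mulrC.
Qed.

Section pushforward_affine.
Variables (a b : R).
Hypothesis a0 : 0 < a.

Let affine_measure : {measure set (measurableTypeR R) -> \bar R} :=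
  measure_function_pushforward__canonical__measure_function_Measure
    mu (measurable_affine a b).

Lemma lebesgue_measure_affine A : measurable A ->
  mscale (NngNum (ltW a0)) affine_measure A = mu A.
Proof.
move=> mA; apply/esym/lebesgue_measure_unique => // _ [[x y]] _ <-.
rewrite /= /mscale /affine_measure /= /pushforward affine_preimage_oc// !lebesgue_measure_itv /= !lte_fin.
rewrite ltr_pM2r ?invr_gt0// ltrD2r.
case: ifP => _; last by rewrite mule0.
by rewrite -!EFinB -EFinM; congr EFin; field; rewrite gt_eqF.
Qed.

Lemma ge0_integral_affine_gt0 (f : R -> \bar R) :
  measurable_fun setT f -> (forall x, 0 <= f x)%E ->
  (a%:E * \int[mu]_x f (a * x + b)%R = \int[mu]_x f x)%E.
Proof.
move=> mf f0.
have -> : (\int[mu]_x f (a * x + b)%R = \int[affine_measure]_x f x)%E.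
  by rewrite (ge0_integral_pushforward (measurable_affine a b)).
rewrite -(ge0_integral_mscale _ _ (NngNum (ltW a0)))//.
by apply: eq_measure_integral => A mA _; exact: lebesgue_measure_affine.
Qed.

End pushforward_affine.

Lemma ge0_integral_affine (a b : R) (f : R -> \bar R) : a != 0 ->
  measurable_fun setT f -> (forall x, 0 <= f x)%E ->
  (`|a|%:E * \int[mu]_x f (a * x + b)%R = \int[mu]_x f x)%E.
Proof.
move=> a0 mf f0.
have [a_gt0|] := ltP 0 a; first by rewrite gtr0_norm// ge0_integral_affine_gt0.
rewrite le_eqVlt (negbTE a0)/= => a_lt0; rewrite ltr0_norm//.
have Na_gt0 : 0 < - a by rewrite oppr_gt0.
rewrite -[RHS](ge0_integral_affine_gt0 (a := - a) b)//.
congr (_ * _)%E.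
have mg : measurable_fun setT (fun x => f (- a * x + b)).
  exact: (measurableT_comp mf (measurable_affine _ _)).
transitivity (\int[pushforward mu (-%R : _ -> measurableTypeR R)]_x f (- a * x + b)%R)%E.
  rewrite ge0_integral_pushforward//=; first by apply: eq_integral => x _ /=; rewrite mulrNN.
apply: eq_measure_integral => A mA _; exact: lebesgue_measureN.
Qed.

End Affine1D.

Section LinearChange.
Context {R : realType}.
Notation rV d := (d.-tuple (measurableTypeR R)).
Notation mu := (@lebesgue_measure R).

(** Measurability on column vectors is read on tuples through [colt], in agreement with
    [cV_measurable_fun]. *)
Definition measurableV d dT (T : measurableType dT) (h : 'cV[R]_d -> T) : Prop :=
  measurable_fun [set: rV d] (fun t => h (colt t)).

Definition lint d (h : 'cV[R]_d -> \bar R) : \bar R :=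
  (\int[lebesgue d]_t h (colt t))%E.

Lemma measurableV_coord d (i : 'I_d) : measurableV (fun v : 'cV[R]_d => v i 0 : R).
Proof.
rewrite /measurableV; under eq_fun do rewrite mxE.
exact: measurable_tnth.
Qed.

Lemma measurable_to_col dT (T : measurableType dT) d (g : T -> 'cV[R]_d)
    d2 (T2 : measurableType d2) (h : 'cV[R]_d -> T2) :
  (forall i, measurable_fun setT (fun x => g x i 0 : R)) -> measurableV h ->
  measurable_fun setT (h \o g).
Proof.
move=> mg mh.
pose g' x : rV d := [tuple (g x i 0 : measurableTypeR R) | i < d].
have -> : h \o g = (fun t => h (colt t)) \o g'.
  apply/funext => x /=; congr h; apply/colP => i.
  by rewrite mxE tnth_mktuple.
apply: (measurableT_comp mh); apply/measurable_fun_tnthP => i.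
apply: eq_measurable_fun (mg i) => x _ /=; by rewrite tnth_mktuple.
Qed.

Lemma measurableV_affine_coord d d' (A : 'M[R]_(d', d)) b i :
  measurableV (fun v => (A *m v + b) i 0 : R).
Proof.
rewrite /measurableV; under eq_fun do rewrite 2!mxE.
apply: measurable_funD => //; apply: measurable_sum => j.
by apply: measurable_funM => //; exact: measurableV_coord.
Qed.

Lemma measurableV_affine d d' (A : 'M[R]_(d', d)) b
    d2 (T2 : measurableType d2) (h : 'cV[R]_d' -> T2) :
  measurableV h -> measurableV (fun v => h (A *m v + b)).
Proof.
by move=> mh; apply: (measurable_to_col _ mh) => i; exact: measurableV_affine_coord.
Qed.

Lemma measurableV_linear d d' (A : 'M[R]_(d', d))
    d2 (T2 : measurableType d2) (h : 'cV[R]_d' -> T2) :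
  measurableV h -> measurableV (fun v => h (A *m v)).
Proof.
move=> /(@measurableV_affine _ _ A 0); rewrite /measurableV.
by under eq_fun do rewrite addr0.
Qed.

Lemma measurableV_shift d b d2 (T2 : measurableType d2) (h : 'cV[R]_d -> T2) :
  measurableV h -> measurableV (fun v => h (v + b)).
Proof.
move=> /(@measurableV_affine _ _ 1%:M b); rewrite /measurableV.
by under eq_fun do rewrite mul1mx.
Qed.

Lemma colt_consp d (x : R) (t : rV d) :
  colt (consp (x, t)) = col_mx x%:M (colt t) :> 'cV[R]_(1 + d).
Proof.
apply/colP => i; rewrite mxE; case: (fintype.splitP i) => j ij.
  have -> : i = lshift d j by exact: val_inj.
  by rewrite col_mxEu mxE !ord1 eqxx mulr1n (tnth_nth 0).
have -> : i = rshift 1 j by exact: val_inj.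
by rewrite col_mxEd mxE !(tnth_nth 0).
Qed.

Lemma measurable_col_mx d (h : 'cV[R]_(1 + d) -> \bar R) : measurableV h ->
  measurable_fun setT
    (fun z : measurableTypeR R * rV d => h (col_mx z.1%:M (colt z.2))).
Proof.
move=> mh; rewrite (_ : (fun _ => _) = (fun t => h (colt t)) \o @consp R d).
  exact: measurableT_comp.
by apply/funext => -[x t] /=; rewrite colt_consp.
Qed.

Lemma lint_ge0 d (h : 'cV[R]_d -> \bar R) : (forall v, 0 <= h v)%E -> (0 <= lint h)%E.
Proof. by move=> h0; exact: integral_ge0. Qed.

Lemma lint0 (h : 'cV[R]_0 -> \bar R) : lint h = h 0.
Proof.
rewrite /lint /= (_ : (fun t => _) = cst (h 0)) ?integral_cst//=.
  by rewrite diracT mule1.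
by apply/funext => t /=; congr h; apply/colP => -[].
Qed.

Lemma lintS_prod d (h : 'cV[R]_(1 + d) -> \bar R) : measurableV h ->
  (forall v, 0 <= h v)%E ->
  lint h = (\int[mu \x lebesgue d]_z h (col_mx z.1%:M (colt z.2)))%E.
Proof.
move=> mh h0; rewrite /lint /= /lebesgue_step.
rewrite ge0_integral_pushforward//.
by apply: eq_integral => -[x t] _ /=; rewrite colt_consp.
Qed.

Lemma lintS d (h : 'cV[R]_(1 + d) -> \bar R) : measurableV h ->
  (forall v, 0 <= h v)%E ->
  lint h = (\int[mu]_x lint (fun v => h (col_mx x%:M v)))%E.
Proof.
by move=> mh h0; rewrite lintS_prod// fubini_tonelli1//; exact: measurable_col_mx.
Qed.

(** The opposite order of integration serves the upper shears, which translate the first coordinate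
    by an amount depending on the others. *)
Lemma lintS' d (h : 'cV[R]_(1 + d) -> \bar R) : measurableV h ->
  (forall v, 0 <= h v)%E ->
  lint h = lint (fun v => \int[mu]_x h (col_mx x%:M v))%E.
Proof.
move=> mh h0; rewrite lintS_prod// fubini_tonelli1//; last exact: measurable_col_mx.
by rewrite fubini_tonelli//; exact: measurable_col_mx.
Qed.

Lemma measurable_lint d (h : 'cV[R]_(1 + d) -> \bar R) : measurableV h ->
  (forall v, 0 <= h v)%E ->
  measurable_fun setT (fun x : measurableTypeR R => lint (fun v => h (col_mx x%:M v))).
Proof.
move=> mh h0.
exact: (@measurable_fun_fubini_tonelli_F _ _ _ _ _ (lebesgue d) _
  (measurable_col_mx mh) (fun=> h0 _)).
Qed.

Lemma measurableV_fix1 d (h : 'cV[R]_(1 + d) -> \bar R) x : measurableV h ->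
  measurableV (fun v => h (col_mx x%:M v)).
Proof.
move=> mh.
exact: (measurableT_comp (measurable_col_mx mh) (pair1_measurable (x : measurableTypeR R))).
Qed.

Lemma measurable_fix2 d (h : 'cV[R]_(1 + d) -> \bar R) v : measurableV h ->
  measurable_fun setT (fun x : R => h (col_mx x%:M v)).
Proof.
move=> mh; pose t : rV d := [tuple (v i 0 : measurableTypeR R) | i < d].
have <- : colt t = v by apply/colP => i; rewrite mxE tnth_mktuple.
exact: (measurableT_comp (measurable_col_mx mh) (pair2_measurable t)).
Qed.

End LinearChange.

Section LinearChange.
Context {R : realType}.
Notation mu := (@lebesgue_measure R).

Lemma ge0_lint_shift d (b : 'cV[R]_d) (h : 'cV[R]_d -> \bar R) : measurableV h ->
  (forall v, 0 <= h v)%E -> lint (fun v => h (v + b)) = lint h.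
Proof.
elim: d b h => [|d IH] b h mh h0.
  by rewrite !lint0; congr h; apply/colP => -[].
rewrite -[d.+1]/(1 + d)%N in b h mh h0 *.
have b1 : b = col_mx (b 0 0)%:M (dsubmx b).
  rewrite -[LHS]vsubmxK; congr col_mx; rewrite [LHS]mx11_scalar mxE.
  by congr ((b _ _)%:M); exact: val_inj.
rewrite (lintS mh h0) (lintS (measurableV_shift b mh) (fun=> h0 _)).
rewrite -[RHS](ge0_integral_affine (a := 1) (b 0 0)) ?oner_eq0//; last 2 first.
- exact: measurable_lint.
- by move=> x; apply: lint_ge0.
rewrite normr1 mul1e; apply: eq_integral => x _.
rewrite -[RHS](IH (dsubmx b)) //; last exact: measurableV_fix1.
congr lint; apply/funext => v; congr h.
by rewrite [in LHS]b1 add_col_mx mul1r raddfD.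
Qed.

(** The property is stable under products, so it only has to be checked on the factors of an
    elimination. Nonnegative functions allow Tonelli at each step. *)
Definition lint_scales d (A : 'M[R]_d) := forall h : 'cV[R]_d -> \bar R,
  measurableV h -> (forall v, 0 <= h v)%E ->
  (`|\det A|%:E * lint (fun v => h (A *m v)) = lint h)%E.

Lemma lint_scales_mul d (A B : 'M[R]_d) :
  lint_scales A -> lint_scales B -> lint_scales (A *m B).
Proof.
move=> sA sB h mh h0; rewrite det_mulmx normrM EFinM -muleA.
rewrite -(sA h)//; congr (_ * _)%E.
rewrite -(sB (fun v => h (A *m v)))//; last exact: measurableV_linear.
by under [in RHS]eq_fun do rewrite mulmxA.
Qed.

Lemma lint_scales_upper d (u : 'rV[R]_d) :
  lint_scales (block_mx 1%:M u 0 1%:M : 'M[R]_(1 + d)).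
Proof.
move=> h mh h0; rewrite det_ublock !det1 mulr1 normr1 mul1e.
rewrite (lintS' mh h0) (lintS' (measurableV_linear _ mh) (fun=> h0 _)).
congr lint; apply/funext => v.
rewrite -[RHS](ge0_integral_affine (a := 1) ((u *m v) 0 0)) ?oner_eq0//; last first.
  exact: measurable_fix2.
rewrite normr1 mul1e; apply: eq_integral => x _; congr h.
rewrite mul_block_col !mul1mx mul0mx add0r; congr col_mx.
by rewrite {1}[u *m v]mx11_scalar mul1r raddfD.
Qed.

(** Once the first coordinate x is frozen, the shear is the translation of the others by w x. *)
Lemma lint_scales_lower d (w : 'cV[R]_d) :
  lint_scales (block_mx 1%:M 0 w 1%:M : 'M[R]_(1 + d)).
Proof.
move=> h mh h0; rewrite det_lblock !det1 mulr1 normr1 mul1e.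
rewrite (lintS mh h0) (lintS (measurableV_linear _ mh) (fun=> h0 _)).
apply: eq_integral => x _.
rewrite -[RHS](ge0_lint_shift (w *m x%:M)) //; last exact: measurableV_fix1.
congr lint; apply/funext => v; congr h.
by rewrite mul_block_col !mul1mx mul0mx addr0 addrC.
Qed.

Lemma lint_scales_diag d (a : R) (A : 'M[R]_d) : a != 0 -> lint_scales A ->
  lint_scales (block_mx a%:M 0 0 A : 'M[R]_(1 + d)).
Proof.
move=> a0 sA h mh h0; rewrite det_lblock det_scalar expr1 normrM EFinM -muleA.
rewrite (lintS mh h0) (lintS (measurableV_linear _ mh) (fun=> h0 _)).
rewrite -[RHS](ge0_integral_affine 0 a0)//; last 2 first.
- exact: measurable_lint.
- by move=> x; exact: lint_ge0.
congr (_ * _)%E; rewrite -ge0_integralZl//; last 2 first.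
- exact: (measurable_lint (measurableV_linear _ mh) (fun=> h0 _)).
- by move=> x _; exact: lint_ge0.
apply: eq_integral => x _.
rewrite -[RHS]sA//; last exact: measurableV_fix1.
congr (_ * lint _)%E; apply/funext => v; congr h.
rewrite mul_block_col !mul0mx addr0 add0r; congr col_mx.
by rewrite -scalar_mxM addr0.
Qed.

(* When A 0 0 != 0, A is a lower shear times a block diagonal matrix times an
   upper shear; otherwise, add another row to the first one beforehand. *)
Lemma lint_scales_unit d (A : 'M[R]_d) : A \in unitmx -> lint_scales A.
Proof.
elim: d A => [|d IH] A uA.
  move=> h mh h0; rewrite det_mx00 normr1 mul1e !lint0; congr h.
  by apply/colP => -[].
rewrite -[d.+1]/(1 + d)%N in A uA *.
wlog a0 : A uA / A 0 0 != 0 => [W|].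
  have [a0|] := eqVneq (A 0 0) 0; last exact: W.
  have [i Ai0] : exists i, A (rshift 1 i) 0 != 0.
    apply: contrapT => /forallNP A0.
    have : A *m delta_mx 0 (0 : 'I_1) = 0.
      rewrite -colE; apply/colP => j; rewrite !mxE.
      case: (fintype.splitP j) => k jk.
        by rewrite -a0; congr (A _ _); apply: val_inj; rewrite /= jk ord1.
      have -> : j = rshift 1 k by exact: val_inj.
      by apply/eqP; apply: contrapT => /negP; exact: A0.
    move=> /(f_equal (mulmx (invmx A))); rewrite mulKmx// mulmx0.
    by move=> /matrixP/(_ 0 0); rewrite !mxE !eqxx => /eqP; rewrite oner_eq0.
  pose E s : 'M[R]_(1 + d) := block_mx 1%:M (s *: delta_mx 0 i) 0 1%:M.
  have EE : E (-1) *m E 1 = 1%:M.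
    rewrite mulmx_block !(mulmx0, mul0mx, mul1mx, mulmx1, addr0, add0r).
    by rewrite -scalerDl subrr scale0r -scalar_mx_block.
  have -> : A = E (-1) *m (E 1 *m A) by rewrite mulmxA EE mul1mx.
  apply: lint_scales_mul; first exact: lint_scales_upper.
  apply: W; first by rewrite unitmx_mul uA andbT; case: (mulmx1_unit EE).
  rewrite -[A]submxK mulmx_block !mul1mx scale1r.
  have -> : 0 = lshift d (0 : 'I_1) :> 'I_(1 + d) by exact: val_inj.
  rewrite block_mxEul mxE [ulsubmx A 0 0]mxE mxE.
  have -> : lshift d (0 : 'I_1) = 0 :> 'I_(1 + d) by exact: val_inj.
  rewrite a0 add0r -rowE 3!mxE.
  by have -> : lshift d (0 : 'I_1) = 0 :> 'I_(1 + d) by exact: val_inj.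
pose a := A 0 0; pose u := a^-1 *: ursubmx A; pose w := a^-1 *: dlsubmx A.
pose A' := drsubmx A - a^-1 *: (dlsubmx A *m ursubmx A).
have AE : A = block_mx 1%:M 0 w 1%:M *m block_mx a%:M 0 0 A' *m block_mx 1%:M u 0 1%:M.
  rewrite !mulmx_block !(mulmx0, mul0mx, mul1mx, mulmx1, addr0, add0r).
  rewrite -[LHS]submxK; congr block_mx.
  - by rewrite [LHS]mx11_scalar !mxE; congr ((A _ _)%:M); exact: val_inj.
  - by rewrite mul_scalar_mx scalerA divff// scale1r.
  - by rewrite mul_mx_scalar scalerA divff// scale1r.
  - rewrite /A' mul_mx_scalar scalerA divff// scale1r -scalemxAr.
    by rewrite addrC subrK.
have uA' : A' \in unitmx.
  move: uA; rewrite !unitmxE !unitfE AE !det_mulmx !det_lblock det_ublock !det1.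
  by rewrite !mulr1 mul1r mulf_eq0 => /norP[].
rewrite AE; apply: lint_scales_mul; last exact: lint_scales_upper.
apply: lint_scales_mul; first exact: lint_scales_lower.
by apply: lint_scales_diag => //; exact: IH.
Qed.

End LinearChange.

(** * The standard normal law *)

Section SignedChange.
Context {R : realType}.

(** A positive finite factor distributes even over differences of infinite values. The change of
    variables therefore passes from positive and negative parts to h, also when its integral is
    infinite. *)
Lemma gt0_muleBr (r : R) (x y : \bar R) : 0 < r ->
  (r%:E * (x - y) = r%:E * x - r%:E * y)%E.
Proof.
move=> r0; case: x => [x| |]; case: y => [y| |] //=;
  rewrite ?(gt0_muley, gt0_muleNy) ?lte_fin//= ?(gt0_muley, gt0_muleNy) ?lte_fin//.
by rewrite -EFinB -!EFinM -EFinB mulrBr.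
Qed.

Lemma measurableV_funepos d (h : 'cV[R]_d -> \bar R) :
  measurableV h -> measurableV h^\+%E.
Proof.
move=> mh; rewrite /measurableV.
rewrite (_ : (fun t => _) = (fun t => h (colt t))^\+%E).
  exact: measurable_funepos.
by apply/funext => t; rewrite !funeposE.
Qed.

Lemma measurableV_funeneg d (h : 'cV[R]_d -> \bar R) :
  measurableV h -> measurableV h^\-%E.
Proof.
move=> mh; rewrite /measurableV.
rewrite (_ : (fun t => _) = (fun t => h (colt t))^\-%E).
  exact: measurable_funeneg.
by apply/funext => t; rewrite !funenegE.
Qed.

Lemma lint_posneg d (h : 'cV[R]_d -> \bar R) : lint h = (lint h^\+ - lint h^\-)%E.
Proof.
rewrite /lint integralE; congr (_ - _)%E; apply: eq_integral => t _.
- by rewrite !funeposE.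
- by rewrite !funenegE.
Qed.

Lemma lint_linear_change d (A : 'M[R]_d) (h : 'cV[R]_d -> \bar R) :
  A \in unitmx -> measurableV h ->
  (`|\det A|%:E * lint (fun v => h (A *m v)) = lint h)%E.
Proof.
move=> uA mh; rewrite lint_posneg [RHS]lint_posneg gt0_muleBr; last first.
  by rewrite normr_gt0 -unitfE -unitmxE.
congr (_ - _)%E.
- rewrite -(lint_scales_unit uA (measurableV_funepos mh))//; congr (_ * lint _)%E.
  by apply/funext => v; rewrite !funeposE.
- rewrite -(lint_scales_unit uA (measurableV_funeneg mh))//; congr (_ * lint _)%E.
  by apply/funext => v; rewrite !funenegE.
Qed.

Lemma lint_translate d (b : 'cV[R]_d) (h : 'cV[R]_d -> \bar R) : measurableV h ->
  lint (fun v => h (v + b)) = lint h.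
Proof.
move=> mh; rewrite lint_posneg [RHS]lint_posneg; congr (_ - _)%E.
- rewrite -(ge0_lint_shift b (measurableV_funepos mh))//; congr lint.
  by apply/funext => v; rewrite !funeposE.
- rewrite -(ge0_lint_shift b (measurableV_funeneg mh))//; congr lint.
  by apply/funext => v; rewrite !funenegE.
Qed.

Lemma lint_Zl d (c : R) (h : 'cV[R]_d -> \bar R) : 0 < c -> measurableV h ->
  (lint (fun v => c%:E * h v) = c%:E * lint h)%E.
Proof.
move=> c0 mh; rewrite lint_posneg [in RHS]lint_posneg gt0_muleBr//.
rewrite ge0_funeposM ?ltW// ge0_funenegM ?ltW//; congr (_ - _)%E.
- by rewrite /lint ge0_integralZl_EFin ?ltW//; exact: measurableV_funepos.
- by rewrite /lint ge0_integralZl_EFin ?ltW//; exact: measurableV_funeneg.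
Qed.

End SignedChange.

Section StandardNormal.
Context {R : realType}.
Notation mu := (@lebesgue_measure R).

Definition stdpdf d (u : 'cV[R]_d) : R :=
  (Num.sqrt ((2 * pi) ^+ d))^-1 * expR (- (sqnorm u / 2)).

Definition stdE d (h : 'cV[R]_d -> R) : \bar R :=
  lint (fun u => (h u * stdpdf u)%:E).

Lemma twopi_gt0 : 0 < 2 * pi :> R.
Proof. by rewrite mulr_gt0 ?pi_gt0. Qed.

Lemma stdpdf_gt0 d (u : 'cV[R]_d) : 0 < stdpdf u.
Proof.
by rewrite mulr_gt0 ?expR_gt0// invr_gt0 sqrtr_gt0 exprn_gt0 ?twopi_gt0.
Qed.

Lemma stdpdf_ge0 d (u : 'cV[R]_d) : 0 <= stdpdf u.
Proof. exact/ltW/stdpdf_gt0. Qed.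

Lemma measurableV_sqnorm d : measurableV (@sqnorm R d).
Proof.
rewrite /measurableV; under eq_fun do rewrite sqnormE.
apply: measurable_sum => i; apply: measurable_funX; exact: measurableV_coord.
Qed.

Lemma measurableV_stdpdf d : measurableV (@stdpdf d).
Proof.
apply: measurable_funM => //; apply: measurableT_comp => //.
apply: measurableT_comp => //; apply: measurable_funM => //.
exact: measurableV_sqnorm.
Qed.

Lemma measurableV_stdE d (h : 'cV[R]_d -> R) : measurableV h ->
  measurableV (fun u => (h u * stdpdf u)%:E).
Proof.
move=> mh; apply/measurable_EFinP; apply: measurable_funM => //.
exact: measurableV_stdpdf.
Qed.

Lemma stdE_ge0 d (h : 'cV[R]_d -> R) : (forall u, 0 <= h u) -> (0 <= stdE h)%E.
Proof. by move=> h0; apply: lint_ge0 => u; rewrite lee_fin mulr_ge0 ?stdpdf_ge0. Qed.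

Lemma ge0_le_stdE d (h k : 'cV[R]_d -> R) : measurableV h -> measurableV k ->
  (forall u, 0 <= h u) -> (forall u, h u <= k u) -> (stdE h <= stdE k)%E.
Proof.
move=> mh mk h0 hk; apply: ge0_le_integral => //.
- by move=> t _; rewrite lee_fin mulr_ge0 ?stdpdf_ge0.
- exact: measurableV_stdE.
- exact: measurableV_stdE.
- by move=> t _; rewrite lee_fin ler_wpM2r ?stdpdf_ge0.
Qed.

Lemma ge0_stdED d (h k : 'cV[R]_d -> R) : measurableV h -> measurableV k ->
  (forall u, 0 <= h u) -> (forall u, 0 <= k u) ->
  (stdE (fun u => h u + k u)%R = stdE h + stdE k)%E.
Proof.
move=> mh mk h0 k0; rewrite /stdE /lint -ge0_integralD//; last 4 first.
- by move=> t _; rewrite lee_fin mulr_ge0 ?stdpdf_ge0.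
- exact: measurableV_stdE.
- by move=> t _; rewrite lee_fin mulr_ge0 ?stdpdf_ge0.
- exact: measurableV_stdE.
by apply: eq_integral => t _; rewrite mulrDl EFinD.
Qed.

Lemma ge0_stdEZ d c (h : 'cV[R]_d -> R) : measurableV h -> 0 <= c ->
  (forall u, 0 <= h u) -> (stdE (fun u => c * h u)%R = c%:E * stdE h)%E.
Proof.
move=> mh c0 h0; rewrite /stdE /lint -ge0_integralZl_EFin//.
- by apply: eq_integral => t _; rewrite -mulrA EFinM.
- by move=> t _; rewrite lee_fin mulr_ge0 ?stdpdf_ge0.
- exact: measurableV_stdE.
Qed.

Lemma sqnorm_orthogonal d (Q : 'M[R]_d) u : Q^T *m Q = 1%:M ->
  sqnorm (Q *m u) = sqnorm u.
Proof.
by move=> Q1; rewrite -quad_gram Q1 /quad /sqnorm mulmx1.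
Qed.

Lemma stdE_orthogonal d (Q : 'M[R]_d) (h : 'cV[R]_d -> R) : Q^T *m Q = 1%:M ->
  measurableV h -> stdE (fun u => h (Q *m u)) = stdE h.
Proof.
move=> Q1 mh; have uQ : Q \in unitmx by case: (mulmx1_unit Q1).
have dQ : `|\det Q| = 1.
  apply/eqP; rewrite -(@eqrXn2 _ 2)// ?expr1n// real_normK ?num_real//.
  by rewrite expr2 -{1}det_tr -det_mulmx Q1 det1.
rewrite /stdE -(lint_linear_change uQ (measurableV_stdE mh)) dQ mul1e.
by congr lint; apply/funext => u; rewrite /stdpdf sqnorm_orthogonal.
Qed.

Lemma sqnorm_col_mx m d (u : 'cV[R]_m) (v : 'cV[R]_d) :
  sqnorm (col_mx u v) = sqnorm u + sqnorm v.
Proof.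
rewrite !sqnormE big_split_ord /=; congr (_ + _); apply: eq_bigr => i _.
- by rewrite col_mxEu.
- by rewrite col_mxEd.
Qed.

Lemma stdE1 d : stdE (fun _ : 'cV[R]_d => 1) = 1%E.
Proof.
elim: d => [|d IH].
  rewrite /stdE lint0 /stdpdf expr0 sqrtr1 invr1 !mul1r sqnormE big_ord0.
  by rewrite mul0r oppr0 expR0.
rewrite /stdE -[d.+1]/(1 + d)%N lintS; last 2 first.
- by apply: measurableV_stdE; exact: measurable_cst.
- by move=> v; rewrite lee_fin mul1r stdpdf_ge0.
rewrite -[RHS](integral_normal_pdf (0 : R) 1); apply: eq_integral => x _.
transitivity ((normal_pdf 0 1 x)%:E * stdE (fun _ : 'cV[R]_d => 1%R))%E; last by rewrite IH mule1.
rewrite /stdE -ge0_integralZl_EFin//; last 3 first.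
- by move=> t _; rewrite lee_fin mul1r stdpdf_ge0.
- exact: (@measurableV_stdE d (fun=> 1) (measurable_cst _)).
- exact: normal_pdf_ge0.
apply: eq_integral => t _; rewrite -EFinM !mul1r; congr EFin.
rewrite /stdpdf sqnorm_col_mx normal_pdfE ?oner_eq0// /normal_peak /normal_fun.
rewrite mulrACA -invfM -sqrtrM ?expr1n ?mul1r ?subr0; last by rewrite mulrn_wge0 ?pi_ge0.
rewrite -(mulr_natl pi 2) -exprS -expRD; congr (_ * expR _).
by rewrite sqnormE big_ord1 mxE eqxx mulr1n; field.
Qed.

End StandardNormal.

Section Moments.
Context {R : realType}.

Definition stdI d (h : 'cV[R]_d -> R) : Prop :=
  (lebesgue d).-integrable setT (fun t => (h (colt t) * stdpdf (colt t))%:E).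

Lemma stdE_fin d (h : 'cV[R]_d -> R) : stdI h -> (stdE h \is a fin_num)%E.
Proof. exact: integrable_fin_num. Qed.

Lemma stdI_ge0 d (h : 'cV[R]_d -> R) : measurableV h -> (forall u, 0 <= h u) ->
  (stdE h < +oo)%E -> stdI h.
Proof.
move=> mh h0 hoo; apply/integrableP; split; first exact: measurableV_stdE.
rewrite (le_lt_trans _ hoo)// /stdE /lint le_eqVlt; apply/orP; left; apply/eqP.
apply: eq_integral => t _; rewrite gee0_abs// lee_fin mulr_ge0//.
exact: stdpdf_ge0.
Qed.

Lemma stdI_le d (h k : 'cV[R]_d -> R) : measurableV h -> stdI k ->
  (forall u, `|h u| <= k u) -> stdI h.
Proof.
move=> mh Ik hk; apply: le_integrable Ik => //; first exact: measurableV_stdE.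
move=> t _; rewrite /= lee_fin !normrM ler_wpM2r// (le_trans (hk _))//.
exact: ler_norm.
Qed.

Lemma stdID d (h k : 'cV[R]_d -> R) : stdI h -> stdI k ->
  stdI (fun u => h u + k u).
Proof.
move=> Ih Ik; apply: eq_integrable (integrableD measurableT Ih Ik) => // t _ /=.
by rewrite mulrDl EFinD.
Qed.

Lemma stdED d (h k : 'cV[R]_d -> R) : stdI h -> stdI k ->
  (stdE (fun u => h u + k u)%R = stdE h + stdE k)%E.
Proof.
move=> Ih Ik; rewrite /stdE /lint -integralD//.
by apply: eq_integral => t _; rewrite mulrDl EFinD.
Qed.

Lemma stdIZ d c (h : 'cV[R]_d -> R) : stdI h -> stdI (fun u => c * h u).
Proof.
move=> Ih; apply: eq_integrable (integrableZl measurableT c Ih) => // t _ /=.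
by rewrite -mulrA EFinM.
Qed.

Lemma stdEZ d c (h : 'cV[R]_d -> R) : stdI h ->
  (stdE (fun u => c * h u)%R = c%:E * stdE h)%E.
Proof.
move=> Ih; rewrite /stdE /lint -integralZl//.
by apply: eq_integral => t _; rewrite -mulrA EFinM.
Qed.

Lemma stdI_cst d c : stdI (fun _ : 'cV[R]_d => c).
Proof.
rewrite (_ : (fun _ => _) = fun _ => c * 1); last by rewrite mulr1.
apply: stdIZ; apply: stdI_ge0 => //; last by rewrite stdE1 ltry.
exact: measurable_cst.
Qed.

Lemma stdE_cst d c : stdE (fun _ : 'cV[R]_d => c) = c%:E.
Proof.
rewrite (_ : (fun _ => _) = fun _ => c * 1); last by rewrite mulr1.
by rewrite stdEZ ?stdE1 ?mule1//; exact: stdI_cst.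
Qed.

Lemma stdI_sum d (I : Type) (s : seq I) (h : I -> 'cV[R]_d -> R) :
  (forall i, stdI (h i)) -> stdI (fun u => \sum_(i <- s) h i u).
Proof.
move=> Ih; elim: s => [|i s IH].
  by under eq_fun do rewrite big_nil; exact: stdI_cst.
by under eq_fun do rewrite big_cons; exact: stdID.
Qed.

Lemma stdE_sum d (I : Type) (s : seq I) (h : I -> 'cV[R]_d -> R) :
  (forall i, stdI (h i)) ->
  stdE (fun u => \sum_(i <- s) h i u) = (\sum_(i <- s) stdE (h i))%E.
Proof.
move=> Ih; elim: s => [|i s IH].
  by under eq_fun do rewrite big_nil; rewrite big_nil stdE_cst.
under eq_fun do rewrite big_cons.
by rewrite big_cons -IH stdED//; exact: stdI_sum.
Qed.

Lemma stdE_odd d (Q : 'M[R]_d) (h : 'cV[R]_d -> R) : Q^T *m Q = 1%:M ->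
  measurableV h -> stdI h -> (forall u, h (Q *m u) = - h u) -> stdE h = 0%E.
Proof.
move=> Q1 mh Ih hQ; have := stdE_orthogonal Q1 mh.
have -> : (fun u => h (Q *m u)) = (fun u => -1 * h u).
  by apply/funext => u; rewrite hQ mulN1r.
rewrite stdEZ//; have := stdE_fin Ih; case: (stdE h) => // x _.
rewrite -EFinM mulN1r => -[] xx; congr EFin.
lra.
Qed.

(** Stated for nonnegative functions because it is applied to the squared error of an arbitrary
    measurable estimator, whose expectation may be infinite. *)
Lemma stdE_avg d (Q : 'M[R]_d) (h : 'cV[R]_d -> R) : Q^T *m Q = 1%:M ->
  measurableV h -> (forall u, 0 <= h u) ->
  stdE h = stdE (fun u => (h u + h (Q *m u)) / 2).
Proof.
move=> Q1 mh h0.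
under [in RHS]eq_fun do rewrite mulrC.
have mQ := measurableV_linear Q mh.
rewrite ge0_stdEZ ?invr_ge0//; last 2 first.
- exact: measurable_funD.
- by move=> u; rewrite addr_ge0.
rewrite ge0_stdED// (stdE_orthogonal Q1 mh) ge0_muleDr ?stdE_ge0//.
rewrite -ge0_muleDl ?lee_fin ?invr_ge0//.
rewrite -EFinD (_ : 2^-1 + 2^-1 = 1 :> R) ?mul1e//.
by field.
Qed.

Section coordinate.
Variables (d : nat) (i : 'I_d).

Definition scale_coord (s : R) : 'M[R]_d :=
  diag_mx (\row_j (if j == i then s else 1)).

Lemma det_scale_coord s : \det (scale_coord s) = s.
Proof.
rewrite det_diag (bigD1 i)//= mxE eqxx big1 ?mulr1// => j ji.
by rewrite mxE (negbTE ji).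
Qed.

Lemma scale_coordE s (u : 'cV[R]_d) j :
  (scale_coord s *m u) j 0 = (if j == i then s else 1) * u j 0.
Proof. by rewrite mul_diag_mx !mxE. Qed.

Lemma sqnorm_scale_coord s u :
  sqnorm (scale_coord s *m u) = sqnorm u + (s ^+ 2 - 1) * u i 0 ^+ 2.
Proof.
rewrite !sqnormE [in LHS](bigD1 i)//= [in RHS](bigD1 i)//= scale_coordE eqxx.
have -> : \sum_(j | j != i) (scale_coord s *m u) j 0 ^+ 2 =
    \sum_(j | j != i) u j 0 ^+ 2.
  by apply: eq_bigr => j ji; rewrite scale_coordE (negbTE ji) mul1r.
ring.
Qed.

Lemma flip_coord_orthogonal : (scale_coord (-1))^T *m scale_coord (-1) = 1%:M.
Proof.
rewrite tr_diag_mx mulmx_diag; apply/matrixP => a b; rewrite !mxE.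
by case: (a == b) => //; rewrite !mulr1n; case: ifP; rewrite ?mulrNN mulr1.
Qed.

(** [psi] is a weight that ignores the coordinate u_i. The case in view is the indicator of an event
    on y with u_i a coordinate of u_x, as conditional expectations require. *)
Variable psi : 'cV[R]_d -> R.
Hypothesis mpsi : measurableV psi.
Hypothesis psi01 : forall u, 0 <= psi u <= 1.
Hypothesis psi_inv : forall s u, psi (scale_coord s *m u) = psi u.

Let psi0 u : 0 <= psi u. Proof. by case/andP: (psi01 u). Qed.

Lemma stdI_01 : stdI psi.
Proof.
apply: (stdI_le mpsi (@stdI_cst d 1)) => u.
by rewrite ger0_norm//; case/andP: (psi01 u).
Qed.

Let mexp s : measurableV (fun u => expR (- ((s ^+ 2 - 1) * u i 0 ^+ 2 / 2)) * psi u).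
Proof.
apply: measurable_funM => //; apply: measurableT_comp => //.
apply: measurableT_comp => //; apply: measurable_funM => //.
apply: measurable_funM => //; apply: measurable_funX; exact: measurableV_coord.
Qed.

Let stdE_scale s : 0 < s ->
  (stdE (fun u => expR (- ((s ^+ 2 - 1) * u i 0 ^+ 2 / 2)) * psi u)%R
   = (s^-1)%:E * stdE psi)%E.
Proof.
move=> s0; have uS : scale_coord s \in unitmx.
  by rewrite unitmxE det_scale_coord unitfE gt_eqF.
rewrite [in RHS]/stdE -(lint_linear_change uS (measurableV_stdE mpsi)).
rewrite det_scale_coord gtr0_norm// muleA -EFinM mulVf ?gt_eqF// mul1e.
congr lint; apply/funext => u; rewrite psi_inv /stdpdf sqnorm_scale_coord.
rewrite (_ : - ((sqnorm u + (s ^+ 2 - 1) * u i 0 ^+ 2) / 2) =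
  - (sqnorm u / 2) + - ((s ^+ 2 - 1) * u i 0 ^+ 2 / 2)); last by field.
by rewrite expRD; congr EFin; ring.
Qed.

Let msq : measurableV (fun u => u i 0 ^+ 2 * psi u).
Proof.
by apply: measurable_funM => //; apply: measurable_funX; exact: measurableV_coord.
Qed.

Let sq0 (u : 'cV[R]_d) : 0 <= u i 0 ^+ 2 * psi u. Proof. by rewrite mulr_ge0// sqr_ge0. Qed.

(** This is 1 - t <= exp(-t) with t = (s^2 - 1) u_i^2 / 2, integrated. The term in t is placed on
    the side where it is nonnegative, here and in [upper], since the second moment is not yet known
    to be finite. *)
Let lower s : 1 < s ->
  (stdE psi <= (s^-1)%:E * stdE psi +
    ((s ^+ 2 - 1) / 2)%:E * stdE (fun u : 'cV[R]_d => u i 0 ^+ 2 * psi u)%R)%E.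
Proof.
move=> s1; have s0 : 0 < s by apply: lt_trans s1.
have s2 : 0 <= (s ^+ 2 - 1) / 2 by nra.
rewrite -stdE_scale// -(ge0_stdEZ msq s2 sq0) -ge0_stdED//; last 3 first.
- exact: measurable_funM.
- by move=> u; rewrite mulr_ge0 ?expR_ge0.
- by move=> u; rewrite mulr_ge0.
apply: ge0_le_stdE => //.
  by apply: measurable_funD; [exact: mexp|exact: measurable_funM].
move=> u.
have := ler_wpM2r (psi0 u) (expR_ge1Dx (- ((s ^+ 2 - 1) * u i 0 ^+ 2 / 2))); lra.
Qed.

Let upper s : 0 < s < 1 ->
  (stdE psi + ((1 - s ^+ 2) / 2)%:E * stdE (fun u : 'cV[R]_d => u i 0 ^+ 2 * psi u)%R <=
   (s^-1)%:E * stdE psi)%E.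
Proof.
move=> /andP[s0 s1].
have s2 : 0 <= (1 - s ^+ 2) / 2 by nra.
rewrite -stdE_scale// -(ge0_stdEZ msq s2 sq0) -ge0_stdED//; last 2 first.
- exact: measurable_funM.
- by move=> u; rewrite mulr_ge0.
apply: ge0_le_stdE => //.
- by apply: measurable_funD; [exact: mpsi|exact: measurable_funM].
- by move=> u; rewrite addr_ge0// mulr_ge0.
move=> u.
have := ler_wpM2r (psi0 u) (expR_ge1Dx (- ((s ^+ 2 - 1) * u i 0 ^+ 2 / 2))); lra.
Qed.

(* Rescaling u_i by s gives E[exp(-(s^2 - 1) u_i^2 / 2) psi] = E[psi] / s;
   with 1 + x <= e^x, letting s tend to 1 from both sides pins down
   E[u_i^2 psi]. *)
Lemma stdE_coord_sq : stdE (fun u : 'cV[R]_d => u i 0 ^+ 2 * psi u) = stdE psi.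
Proof.
have := stdE_fin stdI_01; have := stdE_ge0 psi0.
have : (stdE psi <= 1)%E.
  rewrite -(@stdE1 R d); apply: ge0_le_stdE => //; first exact: measurable_cst.
  by move=> u; case/andP: (psi01 u).
have := stdE_ge0 sq0; move: lower upper.
case: (stdE psi) => // G lo up; move: lo up.
case: (stdE _) => [V| |] //; last first.
  (* The bound [upper] at s = 1/2 excludes an infinite second moment. *)
  have h2 : 0 < (2^-1 : R) < 1 by apply/andP; split; lra.
  move=> _ /(_ _ h2); rewrite -EFinM gt0_muley ?lte_fin ?addey//; lra.
move=> lo up; rewrite !lee_fin => V0 G1 G0 _; congr EFin.
apply/eqP; rewrite eq_le; apply/andP; split; rewrite leNgt; apply/negP => GV.
- have V_gt0 : 0 < V by lra.
  (* With s = 1 - e, [up] reduces to (1 - e/2) (1 - e) V <= G, whose left side exceeds V - 3 e V /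
     2. This e makes the latter the midpoint of G and V, a contradiction. *)
  pose e := (V - G) / (3 * V).
  have eE : e * (3 * V) = V - G by rewrite /e divfK//; lra.
  have e01 : 0 < e < 1.
    apply/andP; split; last by rewrite ltr_pdivrMr ?mulr_gt0//; lra.
    by rewrite divr_gt0 ?subr_gt0 ?mulr_gt0.
  have s01 : 0 < 1 - e < 1 by move: e01 => /andP[? ?]; apply/andP; split; lra.
  have := up _ s01; rewrite -!EFinM -EFinD lee_fin [leRHS]mulrC ler_pdivlMr; last lra.
  nra.
(* With s = 1 + e, [lo] reduces to G <= (1 + e/2) (1 + e) V. Since V < G <= 1, the right side is at
   most V + 2 e, whereas G = V + 4 e. *)
- pose e := (G - V) / 4.
  have s1 : 1 < 1 + e by rewrite /e; lra.
  have := lo _ s1; rewrite -!EFinM -EFinD lee_fin.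
  have -> : (1 + e)^-1 * G = G / (1 + e) by rewrite mulrC.
  have e0 : 0 < 1 + e by lra.
  move=> h; have : G * (1 + e) <= G + ((1 + e) ^+ 2 - 1) / 2 * V * (1 + e).
    by rewrite -(ler_pM2r e0) mulrDl divfK ?gt_eqF// in h.
  have ep : 0 < e by rewrite /e; lra.
  have eE : G = V + 4 * e by rewrite /e; lra.
  have eV : e * V <= e by rewrite ler_piMr//; lra.
  have eeV : e * (e * V) <= e * V.
    by rewrite ler_piMl ?mulr_ge0//; lra.
  clearbody e => h2; have : e * (G - (1 + e / 2) * (1 + e) * V) <= 0 by lra.
  rewrite pmulr_rle0// eE; lra.
Qed.

End coordinate.
End Moments.

Section QuadraticMoments.
Context {R : realType}.

Lemma quadE d (S : 'M[R]_d) u :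
  quad S u = \sum_i \sum_j S i j * (u i 0 * u j 0).
Proof.
rewrite /quad mxE exchange_big /=; apply: eq_bigr => i _.
rewrite !mxE mulr_suml; apply: eq_bigr => j _; rewrite !mxE; ring.
Qed.

Lemma measurableV_quad d (S : 'M[R]_d) : measurableV (quad S).
Proof.
rewrite /measurableV; under eq_fun do rewrite quadE.
apply: measurable_sum => i; apply: measurable_sum => j.
apply: measurable_funM => //.
by apply: measurable_funM; exact: measurableV_coord.
Qed.

Lemma stdI_coord_sq d (i : 'I_d) : stdI (fun u : 'cV[R]_d => u i 0 ^+ 2).
Proof.
apply: stdI_ge0.
- apply: measurable_funX; exact: measurableV_coord.
- by move=> u; exact: sqr_ge0.
- under eq_fun do rewrite -[_ ^+ 2]mulr1.
  rewrite (@stdE_coord_sq _ _ i (fun=> 1)) ?stdE1 ?ltry//; first exact: measurable_cst.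
  by move=> _; rewrite ler01 lexx.
Qed.

Lemma stdI_coord d (i : 'I_d) : stdI (fun u : 'cV[R]_d => u i 0).
Proof.
apply: (stdI_le _ (stdID (stdI_cst d 1) (stdI_coord_sq i))).
  exact: measurableV_coord.
move=> u; rewrite ler_norml; apply/andP; split; nra.
Qed.

Lemma stdI_quad d (S : 'M[R]_d) (psi : 'cV[R]_d -> R) : measurableV psi ->
  (forall u, 0 <= psi u <= 1) -> stdI (fun u => quad S u * psi u).
Proof.
move=> mpsi psi01.
have mij i j : measurableV (fun u : 'cV[R]_d => u i 0 * u j 0).
  by apply: measurable_funM; exact: measurableV_coord.
have Iij i j : stdI (fun u : 'cV[R]_d => u i 0 * u j 0 * psi u).
  apply: (stdI_le _ (stdID (stdI_coord_sq i) (stdI_coord_sq j))).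
    by apply: measurable_funM => //; exact: mij.
  move=> u; have /andP[p0 p1] := psi01 u.
  rewrite normrM (ger0_norm p0).
  apply: (@le_trans _ _ `|u i 0 * u j 0|); first by rewrite ler_piMr.
  rewrite ler_norml; apply/andP; split; nra.
rewrite (_ : (fun u => _) =
    fun u : 'cV[R]_d => \sum_i \sum_j S i j * (u i 0 * u j 0 * psi u)).
  by apply: stdI_sum => i; apply: stdI_sum => j; exact: stdIZ.
apply/funext => u; rewrite quadE mulr_suml; apply: eq_bigr => i _.
by rewrite mulr_suml; apply: eq_bigr => j _; rewrite !mulrA.
Qed.

(** J is a set of coordinates that [psi] ignores, and S only involves these. Off-diagonal terms are
    odd under the flip of one coordinate; diagonal ones are given by [stdE_coord_sq]. *)
Lemma stdE_quad d (S : 'M[R]_d) (psi : 'cV[R]_d -> R) (J : pred 'I_d) : measurableV psi ->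
  (forall u, 0 <= psi u <= 1) ->
  (forall i s u, J i -> psi (scale_coord i s *m u) = psi u) ->
  (forall i j, S i j != 0 -> J i && J j) ->
  stdE (fun u => quad S u * psi u) = ((\tr S)%:E * stdE psi)%E.
Proof.
move=> mpsi psi01 psiJ SJ.
have mij i j : measurableV (fun u : 'cV[R]_d => u i 0 * u j 0 * psi u).
  by apply: measurable_funM => //; apply: measurable_funM; exact: measurableV_coord.
have Iij i j : stdI (fun u : 'cV[R]_d => u i 0 * u j 0 * psi u).
  have := stdI_quad (delta_mx i j) mpsi psi01.
  rewrite (_ : (fun u => quad _ u * _) = fun u : 'cV[R]_d => u i 0 * u j 0 * psi u)//.
  apply/funext => u; rewrite quadE (bigD1 i)//= [X in _ + X]big1 ?addr0; last first.
    by move=> k ki; rewrite big1// => l _; rewrite mxE (negbTE ki) mul0r.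
  rewrite (bigD1 j)//= [X in _ + X]big1 ?addr0; last first.
    by move=> k ki; rewrite mxE (negbTE ki) andbF mul0r.
  by rewrite mxE !eqxx mul1r.
have [g gE] : exists g, stdE psi = g%:E.
  by exists (fine (stdE psi)); rewrite fineK//; exact/stdE_fin/stdI_01.
rewrite (_ : (fun u => _) =
    fun u : 'cV[R]_d => \sum_i \sum_j S i j * (u i 0 * u j 0 * psi u)); last first.
  apply/funext => u; rewrite quadE mulr_suml; apply: eq_bigr => i _.
  by rewrite mulr_suml; apply: eq_bigr => j _; rewrite !mulrA.
rewrite stdE_sum; last by move=> i; apply: stdI_sum => j; exact: stdIZ.
rewrite gE -EFinM /mxtrace mulr_suml -sumEFin; apply: eq_bigr => i _.
rewrite stdE_sum; last by move=> j; exact: stdIZ.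
rewrite (bigD1 i)//= [X in (_ + X)%E]big1 => [|j ji].
  rewrite adde0 stdEZ// EFinM.
  have [->|Sii] := eqVneq (S i i) 0; first by rewrite !mul0e.
  have /andP[Ji _] := SJ _ _ Sii.
  under eq_fun do rewrite -expr2.
  by rewrite (stdE_coord_sq mpsi psi01) ?gE// => s u; exact: psiJ.
rewrite stdEZ//; have [->|Sij] := eqVneq (S i j) 0; first by rewrite mul0e.
have /andP[Ji _] := SJ _ _ Sij.
rewrite (stdE_odd (flip_coord_orthogonal i)) ?mule0// => u.
by rewrite psiJ// !scale_coordE eqxx (negbTE ji); ring.
Qed.

(** Both the log-ratio of two densities with the same support and the squared error of g0 have this
    form in u. *)
Lemma stdE_affine_quad d (S : 'M[R]_d) (b : 'rV[R]_d) (c : R) :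
  stdE (fun u : 'cV[R]_d => quad S u + (b *m u) 0 0 + c) = (\tr S + c)%:E.
Proof.
have I01 : forall u : 'cV[R]_d, 0 <= (1 : R) <= 1 by move=> _; rewrite ler01 lexx.
have IS : stdI (quad S).
  have := @stdI_quad _ S (fun=> 1) (measurable_cst _) I01.
  by under eq_fun do rewrite mulr1.
have Ib : stdI (fun u : 'cV[R]_d => (b *m u) 0 0).
  under eq_fun do rewrite mxE.
  by apply: stdI_sum => j; apply: stdIZ; exact: stdI_coord.
rewrite stdED; [|exact: stdID|exact: stdI_cst].
rewrite stdED// stdE_cst.
have -> : stdE (quad S) = (\tr S)%:E.
  have := @stdE_quad _ S (fun=> 1) xpredT (measurable_cst _) I01.
  under eq_fun do rewrite mulr1.
  by rewrite stdE1 mule1; apply.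
rewrite (@stdE_odd _ _ (-1)%:M (fun u => (b *m u) 0 0)) ?adde0 ?EFinD//.
- by rewrite tr_scalar_mx -scalar_mxM mulrNN mulr1.
- rewrite /measurableV; under eq_fun do rewrite mxE.
  by apply: measurable_sum => j; apply: measurable_funM => //; exact: measurableV_coord.
- by move=> u; rewrite mul_scalar_mx scaleN1r mulmxN mxE.
Qed.

End QuadraticMoments.

(** * Integration over the support of a degenerate Gaussian density *)

Section Chart.
Context {R : realType}.

Lemma row_full_change N k (B C : 'M[R]_(N, k)) : row_full B -> row_full C ->
  mximage B = mximage C -> exists2 M : 'M[R]_k, M \in unitmx & B = C *m M.
Proof.
move=> fB fC /mximage_eqP[[X BX] [Y CY]]; exists X => //.
have : X *m Y = 1%:M.
  by apply: (row_full_inj fC); rewrite mulmxA -BX -CY mulmx1.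
by case/mulmx1_unit.
Qed.

Lemma mximage_col_base m n (A : 'M[R]_(m, n)) : mximage (col_base A) = mximage A.
Proof.
apply/esym/mximage_sub_rank; last by rewrite (eqP (col_base_full A)).
by apply/mximage_subP; exists (row_base A); rewrite mulmx_base.
Qed.

(** Any basis of the direction space and any origin of the support may replace those of the
    definition: a change of basis M multiplies the volume factor by |det M|, which the linear change
    of variables absorbs, and a change of origin is a translation. Hence all densities with one
    support can be integrated in a single chart. *)
Lemma gsupp_integral_chart N k (f : @gauss R N) (C : 'M[R]_(N, k)) m0 dl
    (h : 'cV[R]_N -> \bar R) : row_full C -> mximage (gcov f) = mximage C ->
  gmean f = m0 + C *m dl -> measurableV h ->
  gsupp_integral f h =
  ((Num.sqrt (\det (C^T *m C)))%:E * lint (fun u => h (m0 + C *m u)%R))%E.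
Proof.
move=> fC KC mE mh.
have rk : \rank (gcov f) = k by rewrite (mximage_rank KC) (eqP fC).
rewrite /gsupp_integral /gvol /gchart mE.
(* The width of the basis is a rank that equals k only propositionally; the basis is generalized so
   that this equality can be substituted in the types. *)
move: (col_base (gcov f)) (col_base_full (gcov f)) (mximage_col_base (gcov f)).
rewrite KC; move: (\rank _) rk => k' rk; move: rk C dl fC mE {KC} => <- C dl fC mE B fB BC.
have [M uM ->] := row_full_change fB fC BC.
have mg : measurableV (fun u => h (m0 + C *m u)).
  have := measurableV_affine C m0 mh; rewrite /measurableV.
  by under eq_fun do rewrite addrC.
have dM : \det M != 0 by rewrite -unitfE -unitmxE.
have -> : Num.sqrt (\det ((C *m M)^T *m (C *m M))) =
    Num.sqrt (\det (C^T *m C)) * `|\det M|.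
  rewrite trmx_mul -mulmxA [C^T *m (_ *m _)]mulmxA !det_mulmx det_tr.
  rewrite mulrCA -expr2 sqrtrM ?sqrtr_sqr//.
  exact/ltW/det_gram_gt0.
rewrite EFinM -muleA; congr (_ * _)%E.
pose g v := h (m0 + C *m (v + dl)).
have mg' : measurableV g by exact: measurableV_shift mg.
rewrite -[RHS](lint_translate dl mg) -[RHS](lint_linear_change uM mg').
congr (_ * _)%E; apply: eq_integral => t _; rewrite /g; congr h.
by rewrite mulmxDr mulmxA -addrA [C *m dl + _]addrC.
Qed.

Lemma gvol_gt0 N (f : @gauss R N) : 0 < gvol f.
Proof. by rewrite sqrtr_gt0 det_gram_gt0// col_base_full. Qed.

End Chart.

Section GaussianExpectation.
Context {R : realType} (N k : nat) (m : 'cV[R]_N) (C : 'M[R]_(N, k)).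
Hypothesis fC : row_full C.
Let f := Gauss m (C *m C^T).

Let rank_gram : \rank (C *m C^T) = k.
Proof. by rewrite (mximage_rank (mximage_gram fC)) (eqP fC). Qed.

Lemma pdet_gram_gt0 : 0 < pdet (C *m C^T).
Proof. by rewrite pdet_gram// det_gram_gt0. Qed.

Lemma mpinv_gram : mpinv (C *m C^T) = (mpinv C)^T *m mpinv C.
Proof.
have := mpinv_sandwich fC (mulmx1 (1%:M : 'M[R]_k)).
by rewrite !mulmx1.
Qed.

Lemma quad_mpinv_gram u : quad (mpinv (C *m C^T)) (C *m u) = sqnorm u.
Proof. by rewrite mpinv_gram quad_gram mulmxA mpinvK_full// mul1mx. Qed.

Lemma gdens_gauss v : gdens f (m + v) =
  (Num.sqrt ((2 * pi) ^+ k * pdet (C *m C^T)))^-1 *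
  expR (- (quad (mpinv (C *m C^T)) v / 2)).
Proof. by rewrite /gdens /= rank_gram addrAC subrr add0r. Qed.

(** The pseudo-determinant in the normalization is the squared volume factor of the chart, so the
    two cancel and the standard normal density is left. *)
Lemma gdens_chart u :
  Num.sqrt (\det (C^T *m C)) * gdens f (m + C *m u) = stdpdf u.
Proof.
rewrite gdens_gauss quad_mpinv_gram /stdpdf pdet_gram// mulrA; congr (_ * _).
have d0 := det_gram_gt0 fC.
rewrite sqrtrM; last by rewrite exprn_ge0 ?ltW ?twopi_gt0.
by rewrite invfM mulrCA divff ?mulr1// gt_eqF// sqrtr_gt0.
Qed.

Lemma measurableV_gdens : measurableV (gdens f).
Proof.
rewrite (_ : gdens f = fun z => gdens f (m + (z - m))); last first.
  by apply/funext => z; rewrite addrC subrK.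
have -> : (fun z => gdens f (m + (z - m))) = fun z =>
  (Num.sqrt ((2 * pi) ^+ k * pdet (C *m C^T)))^-1 *
  expR (- (quad (mpinv (C *m C^T)) (z - m) / 2)).
  by apply/funext => z; rewrite gdens_gauss.
apply: measurable_funM => //; apply: measurableT_comp => //.
apply: measurableT_comp => //; apply: measurable_funM => //.
exact: (measurableV_shift (- m) (measurableV_quad _)).
Qed.

Lemma measurableV_chart dT (T : measurableType dT) (h : 'cV[R]_N -> T) :
  measurableV h -> measurableV (fun u => h (m + C *m u)).
Proof.
move=> /(measurableV_affine C m); rewrite /measurableV.
by under eq_fun do rewrite addrC.
Qed.

Lemma gexp_stdE (h : 'cV[R]_N -> R) : measurableV h ->
  gexp f h = stdE (fun u => h (m + C *m u)).
Proof.
move=> mh; have d0 := det_gram_gt0 fC.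
have mhg : measurableV (fun z => (h z * gdens f z)%:E).
  apply/measurable_EFinP; apply: measurable_funM => //.
  exact: measurableV_gdens.
rewrite /gexp (gsupp_integral_chart (C := C) (m0 := m) (dl := 0))//.
- rewrite -lint_Zl ?sqrtr_gt0//; last exact: (measurableV_chart mhg).
  congr lint; apply/funext => u; rewrite -EFinM; congr EFin.
  by rewrite mulrCA gdens_chart.
- exact: mximage_gram.
- by rewrite mulmx0 addr0.
Qed.

(** Integrability is defined in the chart given by [col_base]. It is transferred from the chart C
    through the finiteness of the expectation of |h|, the volume factor being positive. *)
Lemma gintegrable_stdI (h : 'cV[R]_N -> R) : measurableV h ->
  stdI (fun u => h (m + C *m u)) -> gintegrable f h.
Proof.
move=> mh /integrableP[_ hoo]; apply/integrableP; split.
  apply/measurable_EFinP; apply: measurable_funM.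
    have := measurableV_affine (col_base (gcov f)) m mh; rewrite /measurableV.
    by under eq_fun do rewrite addrC.
  have := measurableV_affine (col_base (gcov f)) m measurableV_gdens.
  by rewrite /measurableV; under eq_fun do rewrite addrC.
have mh' : measurableV (fun z => `|h z|) by exact: measurableT_comp.
have gd0 z : 0 <= gdens f z.
  by rewrite mulr_ge0 ?expR_ge0// invr_ge0.
have : (gexp f (fun z => `|h z|%R) < +oo)%E.
  rewrite gexp_stdE// (le_lt_trans _ hoo)// le_eqVlt; apply/orP; left; apply/eqP.
  apply: eq_integral => t _ /=; congr EFin.
  by rewrite normrM [`|stdpdf _|]ger0_norm ?stdpdf_ge0.
rewrite /gexp /gsupp_integral; set I := integral _ _ _ => Ioo.
have -> : (\int[lebesgue (\rank (gcov f))]_x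
    `|(h (gchart (f := f) x) * gdens f (gchart (f := f) x))%:E| = I)%E.
  apply: eq_integral => t _ /=; congr EFin.
  by rewrite normrM [`|gdens _ _|]ger0_norm.
move: Ioo; have := gvol_gt0 f.
case: I => [r| |] g0; rewrite ?ltry ?ltNyr//.
by rewrite gt0_muley// lte_fin.
Qed.

End GaussianExpectation.

(** * Divergence and risk of a Gaussian density *)

Section Divergence.
Context {R : realType} (N k : nat) (m : 'cV[R]_N) (C : 'M[R]_(N, k)).
Hypothesis fC : row_full C.
Variables (dl : 'cV[R]_k) (L : 'M[R]_k).
Hypothesis uL : L \in unitmx.

Let f := Gauss m (C *m C^T).
Let ft := Gauss (m + C *m dl) (C *m L *m (C *m L)^T).

Let fCL : row_full (C *m L). Proof. exact: row_full_mul_unit. Qed.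

Lemma sqnormD d (u v : 'cV[R]_d) :
  sqnorm (u + v) = sqnorm u + 2 * (u^T *m v) 0 0 + sqnorm v.
Proof.
rewrite !sqnormE [in RHS]mxE mulr_sumr -!big_split /=.
by apply: eq_bigr => i _; rewrite !mxE; ring.
Qed.

Lemma pdet_gram_mul : pdet (C *m L *m (C *m L)^T) = \det L ^+ 2 * pdet (C *m C^T).
Proof.
rewrite !pdet_gram// trmx_mul -mulmxA [C^T *m (_ *m _)]mulmxA !det_mulmx det_tr.
ring.
Qed.

Lemma ln_gdens_ratio z :
  ln (gdens ft z / gdens f z) = - ln `|\det L| +
    (quad (mpinv (gcov f)) (z - m) - quad (mpinv (gcov ft)) (z - gmean ft)) / 2.
Proof.
have dL : 0 < `|\det L| by rewrite normr_gt0 -unitfE -unitmxE.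
have pK : 0 < pdet (C *m C^T) := pdet_gram_gt0 fC.
have pi0 : 0 < (2 * pi) ^+ k :> R by rewrite exprn_gt0 ?twopi_gt0.
have -> : gdens ft z = gdens ft (m + C *m dl + (z - (m + C *m dl))).
  by rewrite addrC subrK.
have -> : gdens f z = gdens f (m + (z - m)) by rewrite [m + _]addrC subrK.
rewrite !gdens_gauss// pdet_gram_mul.
rewrite mulrCA sqrtrM ?sqr_ge0// sqrtr_sqr.
set c := Num.sqrt _; have c0 : 0 < c by rewrite sqrtr_gt0 mulr_gt0.
set a := quad _ _; set b := quad _ _.
have -> : (`|\det L| * c)^-1 * expR (- (a / 2)) / (c^-1 * expR (- (b / 2))) =
    `|\det L|^-1 * expR ((b - a) / 2).
  rewrite !invfM invrK -expRN opprK.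
  have -> : `|\det L|^-1 / c * expR (- (a / 2)) * (c * expR (b / 2)) =
      (c^-1 * c) * `|\det L|^-1 * (expR (- (a / 2)) * expR (b / 2)) by ring.
  rewrite mulVf ?gt_eqF// mul1r -expRD; congr (_ * expR _); lra.
by rewrite lnM ?posrE ?invr_gt0 ?expR_gt0// lnV ?posrE// expRK.
Qed.

Lemma KL_gauss : KL ft f =
  (2^-1 * (sqnorm dl + \tr (L *m L^T) - k%:R) - ln `|\det L|)%:E.
Proof.
rewrite /KL -[LHS]/(gexp ft (fun z => ln (gdens ft z / gdens f z))).
rewrite gexp_stdE//; last first.
  rewrite (_ : (fun z => _) = fun z => - ln `|\det L| +
    (quad (mpinv (gcov f)) (z - m) - quad (mpinv (gcov ft)) (z - gmean ft)) / 2).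
    apply: measurable_funD => //; apply: measurable_funM => //.
    apply: measurable_funB.
      exact: (measurableV_shift (- m) (measurableV_quad _)).
    exact: (measurableV_shift (- gmean ft) (measurableV_quad _)).
  by apply/funext => z; rewrite ln_gdens_ratio.
(* In the chart of [ft] the log-ratio is (|dl + L u|^2 - |u|^2) / 2 - ln |det L|; S is its quadratic
   part. *)
pose S : 'M[R]_k := 2^-1 *: (L^T *m L - 1%:M).
rewrite (_ : (fun u => _) = fun u =>
  quad S u + (dl^T *m L *m u) 0 0 + (sqnorm dl / 2 - ln `|\det L|)).
  rewrite stdE_affine_quad; congr EFin.
  rewrite /S mxtraceZ raddfB /= mxtrace1 mxtrace_mulC; lra.
apply/funext => u; rewrite ln_gdens_ratio /=.
have -> : m + C *m dl + C *m L *m u - m = C *m (dl + L *m u).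
  by rewrite -[m + _ + _]addrA [m + _]addrC addrK mulmxDr mulmxA.
rewrite [X in X - (m + _)]addrC addrK !quad_mpinv_gram// sqnormD.
have -> : quad S u = (sqnorm (L *m u) - sqnorm u) / 2.
  rewrite -quad_gram /quad /S -scalemxAr -scalemxAl mulmxBr mulmxBl mulmx1.
  by rewrite [in LHS]mxE [X in _ * X]mxE [X in _ + X]mxE /sqnorm mulrC.
rewrite mulmxA; lra.
Qed.

Lemma gexp_sqnorm q (A : 'M[R]_(q, N)) :
  gexp ft (fun z => sqnorm (A *m (z - m))) =
  (sqnorm (A *m C *m dl) + \tr ((A *m C *m L)^T *m (A *m C *m L)))%:E.
Proof.
rewrite gexp_stdE//; last first.
  apply: (measurableV_shift (- m) (h := fun z => sqnorm (A *m z))).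
  exact: (measurableV_linear A (@measurableV_sqnorm R q)).
pose D := A *m C *m L.
rewrite (_ : (fun u => _) = fun u => quad (D^T *m D) u +
    ((2 *: ((A *m C *m dl)^T *m D)) *m u) 0 0 + sqnorm (A *m C *m dl)).
  by rewrite stdE_affine_quad addrC.
apply/funext => u.
have -> : m + C *m dl + C *m L *m u - m = C *m (dl + L *m u).
  by rewrite -[m + _ + _]addrA [m + _]addrC addrK mulmxDr mulmxA.
rewrite mulmxA mulmxDr sqnormD mulmxA quad_gram -scalemxAl [in RHS]mxE mulmxA.
rewrite /D !mulmxA; ring.
Qed.

End Divergence.

(** * Posterior law of x given y *)

Lemma sqnorm_parallelogram (R : realType) d (a b : 'cV[R]_d) :
  sqnorm (a - b) + sqnorm (- a - b) = 2 * (sqnorm a + sqnorm b).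
Proof.
rewrite !sqnormE mulrDr !mulr_sumr -!big_split /=.
by apply: eq_bigr => i _; rewrite !mxE; ring.
Qed.

Lemma colB (R : realType) d (a b : 'cV[R]_d) i : (a - b) i 0 = a i 0 - b i 0.
Proof. by rewrite !mxE. Qed.

Section Posterior.
Context {R : realType} (n p r : nat).
Variables (mx : 'cV[R]_n) (my : 'cV[R]_p) (C1 : 'M[R]_(n, r)) (C2 : 'M[R]_p)
  (G : 'M[R]_(n, p)).
Hypothesis fC1 : row_full C1.
Hypothesis uC2 : C2 \in unitmx.

(* With P = C1 C1^T and K_y = C2 C2^T, the covariance K_z is C C^T. If
   z = m + C u with u = (u_x, u_y) standard normal, then y depends on u_y only
   and x - g0(y) = C1 u_x. *)
Definition joint_factor : 'M[R]_(n + p, r + p) := block_mx C1 (G *m C2) 0 C2.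
Let C := joint_factor.
Let f := Gauss (col_mx mx my) (C *m C^T).
Let g0 (y : 'cV[R]_p) := G *m (y - my) + mx.

Lemma joint_factor_full : row_full joint_factor.
Proof.
apply/row_fullP; exists (block_mx (mpinv C1) (- (mpinv C1 *m G)) 0 (invmx C2)).
rewrite mulmx_block !(mulmx0, mul0mx, addr0, add0r) mpinvK_full// mulVmx//.
by rewrite mulNmx mulmxA subrr -scalar_mx_block.
Qed.

Lemma joint_factor_y (u : 'cV[R]_(r + p)) :
  dsubmx (col_mx mx my + C *m u) = my + C2 *m dsubmx u.
Proof.
rewrite -{1}[u]vsubmxK mul_block_col mul0mx add0r add_col_mx.
by rewrite col_mxKd.
Qed.

Lemma joint_factor_resid (u : 'cV[R]_(r + p)) :
  usubmx (col_mx mx my + C *m u) - g0 (dsubmx (col_mx mx my + C *m u)) =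
  C1 *m usubmx u.
Proof.
rewrite joint_factor_y -{1}[u]vsubmxK mul_block_col add_col_mx col_mxKu.
rewrite /g0 [my + _]addrC addrK mulmxA opprD [mx + _]addrC.
by rewrite addrACA subrr addr0 addrK.
Qed.

Definition flip_x : 'M[R]_(r + p) := block_mx (-1)%:M 0 0 1%:M.

Lemma flip_x_orthogonal : flip_x^T *m flip_x = 1%:M.
Proof.
rewrite tr_block_mx mulmx_block !(trmx0, mulmx0, mul0mx, addr0, add0r).
by rewrite !tr_scalar_mx mulmx1 -scalar_mxM mulrNN mulr1 -scalar_mx_block.
Qed.

Lemma flip_xu (u : 'cV[R]_(r + p)) : usubmx (flip_x *m u) = - usubmx u.
Proof.
by rewrite -{1}[u]vsubmxK mul_block_col col_mxKu mul0mx addr0 mul_scalar_mx scaleN1r.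
Qed.

Lemma flip_xd (u : 'cV[R]_(r + p)) : dsubmx (flip_x *m u) = dsubmx u.
Proof.
by rewrite -{1}[u]vsubmxK mul_block_col col_mxKd mul0mx add0r mul1mx.
Qed.

Lemma measurableV_usubmx i : measurableV (fun z : 'cV[R]_(n + p) => usubmx z i 0).
Proof. by rewrite /measurableV; under eq_fun do rewrite mxE; exact: measurableV_coord. Qed.

Lemma measurableV_dsubmx dT (T : measurableType dT) (h : 'cV[R]_p -> T) :
  measurableV h -> measurableV (fun z : 'cV[R]_(n + p) => h (dsubmx z)).
Proof.
move=> mh; apply: (measurable_to_col (g := fun t => dsubmx (colt t))) mh => i.
by under eq_fun do rewrite mxE; exact: measurableV_coord.
Qed.

Lemma measurableV_sqnorm_mul d q (A : 'M[R]_(q, d)) (g : 'cV[R]_(n + p) -> 'cV[R]_d) :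
  (forall i, measurableV (fun z => g z i 0)) ->
  measurableV (fun z => sqnorm (A *m g z)).
Proof.
move=> mg; apply: (measurable_to_col (g := fun t => g (colt t))
  (h := fun v => sqnorm (A *m v))) => //.
exact: (measurableV_linear A (@measurableV_sqnorm R q)).
Qed.

Lemma measurable_g0 : cV_measurable_fun g0.
Proof.
move=> i; rewrite /g0.
have := measurableV_affine_coord G (mx - G *m my) i; rewrite /measurableV.
by under eq_fun do rewrite addrCA addrC -mulmxBr.
Qed.

Section error.
Variables (q : nat) (H : 'M[R]_(q, n)) (g : 'cV[R]_p -> 'cV[R]_n).
Hypothesis mg : cV_measurable_fun g.

Lemma measurableV_error :
  measurableV (fun z : 'cV[R]_(n + p) => sqnorm (H *m (usubmx z - g (dsubmx z)))).
Proof.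
apply: (measurableV_sqnorm_mul H (g := fun z => usubmx z - g (dsubmx z))) => i.
rewrite /measurableV; under eq_fun do rewrite mxE [X in _ + X]mxE.
apply: measurable_funB; first exact: measurableV_usubmx.
exact: (measurableV_dsubmx (h := fun y => g y i 0 : R) (mg i)).
Qed.

Lemma measurableV_discrepancy :
  measurableV (fun z : 'cV[R]_(n + p) =>
    sqnorm (H *m (g (dsubmx z) - g0 (dsubmx z)))).
Proof.
apply: (measurableV_sqnorm_mul H
  (g := fun z => g (dsubmx z) - g0 (dsubmx z))) => i.
rewrite /measurableV; under eq_fun do rewrite mxE [X in _ + X]mxE.
apply: measurable_funB; first exact: (measurableV_dsubmx (h := fun y => g y i 0 : R) (mg i)).
exact: (measurableV_dsubmx (h := fun y => g0 y i 0 : R) (measurable_g0 i)).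
Qed.

End error.

(* Under u_x -> - u_x, the residual x - g0(y) changes sign while y is fixed;
   averaging over this symmetry removes the cross term. *)
Lemma mse_decomposition q (H : 'M[R]_(q, n)) g : cV_measurable_fun g ->
  mse H f g =
  (mse H f g0 + gexp f (fun z => sqnorm (H *m (g (dsubmx z) - g0 (dsubmx z)))))%E.
Proof.
move=> mg; have fC := joint_factor_full.
have mC dT (T : measurableType dT) (h : 'cV[R]_(n + p) -> T) : measurableV h ->
  measurableV (fun u => h (col_mx mx my + C *m u)) by exact: measurableV_chart.
have mE := measurableV_error H mg; have mE0 := measurableV_error H measurable_g0.
have mD := measurableV_discrepancy H mg.
rewrite /mse !gexp_stdE// -ge0_stdED; last 4 first.
- exact: (mC _ _ _ mE0).
- exact: (mC _ _ _ mD).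
- by move=> u; exact: sqnorm_ge0.
- by move=> u; exact: sqnorm_ge0.
rewrite (stdE_avg flip_x_orthogonal (mC _ _ _ mE)); last by move=> u; exact: sqnorm_ge0.
congr stdE; apply/funext => u; rewrite joint_factor_resid.
pose e v := usubmx (col_mx mx my + C *m v) - g (dsubmx (col_mx mx my + C *m v)).
rewrite -/(e u) -/(e (flip_x *m u)).
pose dy := g (dsubmx (col_mx mx my + C *m u)) - g0 (dsubmx (col_mx mx my + C *m u)).
have -> : e u = C1 *m usubmx u - dy.
  by rewrite -joint_factor_resid /dy /e opprB addrA subrK.
have -> : e (flip_x *m u) = - (C1 *m usubmx u) - dy.
  rewrite -mulmxN -flip_xu -joint_factor_resid /dy /e opprB addrA.
  by rewrite !joint_factor_y flip_xd subrK.
by rewrite -/dy !mulmxBr mulmxN sqnorm_parallelogram; field.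
Qed.

Lemma measurableV_indic (B : set 'cV[R]_p) : cV_measurable B ->
  measurableV (\1_B : 'cV[R]_p -> R).
Proof.
move=> mB; rewrite /measurableV.
rewrite (_ : (fun t => _) = \1_(@colt R p @^-1` B)); first exact: measurable_indic.
by apply/funext => t; rewrite !indicE; congr (_%:R); rewrite !inE.
Qed.

Lemma stdI_mul01 d (h psi : 'cV[R]_d -> R) : measurableV h -> measurableV psi ->
  (forall u, 0 <= psi u <= 1) -> stdI h -> stdI (fun u => h u * psi u).
Proof.
move=> mh mpsi psi01 Ih; apply: le_integrable Ih => //.
  exact: (measurableV_stdE (h := fun u => h u * psi u) (measurable_funM mh mpsi)).
move=> t _; have /andP[p0 p1] := psi01 (colt t).
by rewrite /= lee_fin !normrM ler_wpM2r// ler_piMr// ger0_norm.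
Qed.

Lemma stdI_affine_coord d d' (A : 'M[R]_(d', d)) b i :
  stdI (fun u : 'cV[R]_d => (b + A *m u) i 0).
Proof.
under eq_fun do rewrite 2!mxE.
apply: stdID; first exact: stdI_cst.
by apply: stdI_sum => j; apply: stdIZ; exact: stdI_coord.
Qed.

Let indic_y (B : set 'cV[R]_p) (u : 'cV[R]_(r + p)) : R :=
  \1_B (dsubmx (col_mx mx my + C *m u)).

Let indic_y01 B u : 0 <= indic_y B u <= 1.
Proof. by rewrite /indic_y indicE ler0n lern1 leq_b1. Qed.

Let measurableV_indic_y B : cV_measurable B -> measurableV (indic_y B).
Proof.
move=> mB; apply: (measurableV_chart _ _ (h := fun z => \1_B (dsubmx z) : R)).
exact: (measurableV_dsubmx (h := \1_B : _ -> R) (measurableV_indic mB)).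
Qed.

Let residr (i : 'I_n) : 'rV[R]_(r + p) := row_mx (row i C1) 0.

Let residrE i (u : 'cV[R]_(r + p)) : (C1 *m usubmx u) i 0 = (residr i *m u) 0 0.
Proof.
rewrite -[in RHS](vsubmxK u) mul_row_col mul0mx addr0 -row_mul.
by rewrite [RHS]mxE.
Qed.

(** The residual C1 u_x is odd under [flip_x], which preserves y and hence every event on y, so its
    integral over such an event vanishes. *)
Lemma gauss_posterior_mean : posterior_mean f g0.
Proof.
move=> i; have fC := joint_factor_full.
have mphi := @measurableV_usubmx i.
have mh := measurableV_dsubmx (h := fun y => g0 y i 0 : R) (measurable_g0 i).
have gy (u : 'cV[R]_(r + p)) : g0 (dsubmx (col_mx mx my + C *m u)) i 0 =
    (mx + row_mx 0 (G *m C2) *m u) i 0.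
  rewrite joint_factor_y /g0 [my + _]addrC addrK mulmxA.
  by rewrite -[in RHS](vsubmxK u) mul_row_col mul0mx add0r [in RHS]addrC.
have Ih : stdI (fun u : 'cV[R]_(r + p) => g0 (dsubmx (col_mx mx my + C *m u)) i 0).
  by under eq_fun do rewrite gy; exact: stdI_affine_coord.
split.
- exact: measurable_g0.
- apply: gintegrable_stdI => //.
  by under eq_fun do rewrite mxE; exact: stdI_affine_coord.
- exact: gintegrable_stdI.
move=> B mB; have mB1 := measurableV_indic mB.
have mBd := measurableV_dsubmx (h := \1_B : _ -> R) mB1.
rewrite !gexp_stdE//; last 2 first.
- exact: measurable_funM.
- exact: measurable_funM.
have mhu := measurableV_chart (col_mx mx my) C mh.
have mpsi := measurableV_indic_y mB.
pose a (u : 'cV[R]_(r + p)) := (residr i *m u) 0 0.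
have ma : measurableV a.
  have := measurableV_affine_coord (residr i) 0 0; rewrite /measurableV.
  by under eq_fun do rewrite addr0.
have Ia : stdI (fun u => a u * indic_y B u).
  apply: stdI_mul01 => //.
  have := stdI_affine_coord (residr i) 0 0.
  by under eq_fun do rewrite add0r.
have -> : (fun u => usubmx (col_mx mx my + C *m u) i 0 *
      \1_B (dsubmx (col_mx mx my + C *m u))) =
    (fun u => g0 (dsubmx (col_mx mx my + C *m u)) i 0 * indic_y B u +
       a u * indic_y B u).
  apply/funext => u; rewrite -mulrDl; congr (_ * _).
  by rewrite /a -residrE -joint_factor_resid colB [RHS]addrC subrK.
rewrite stdED//; last exact: (stdI_mul01 mhu).
rewrite [X in (_ + X)%E](stdE_odd flip_x_orthogonal) ?adde0//.
  exact: measurable_funM.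
move=> u; rewrite /a -!residrE flip_xu mulmxN mxE mulNr; congr (- (_ * _)).
by rewrite /indic_y !joint_factor_y flip_xd.
Qed.

(** A product of two residuals is a quadratic form in u_x alone, while an event on y depends on u_y
    alone. Its expectation thus factors by [stdE_quad], and the trace of the form is an entry of C1
    C1^T. *)
Lemma gauss_posterior_cov : posterior_cov f g0 (C1 *m C1^T).
Proof.
split; first exact: gauss_posterior_mean.
move=> i j; have fC := joint_factor_full.
pose S := (residr i)^T *m residr j.
have SE (u : 'cV[R]_(r + p)) : (C1 *m usubmx u) i 0 * (C1 *m usubmx u) j 0 = quad S u.
  rewrite !residrE /quad /S !mulmxA -trmx_mul -mulmxA.
  by rewrite [RHS]mxE big_ord1 [_^T _ _]mxE.
have residr_l l b : residr l 0 b != 0 -> exists b' : 'I_r, b = lshift p b'.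
  case: (fintype.splitP b) => b' bb'; first by exists b'; exact: val_inj.
  have -> : b = rshift r b' by exact: val_inj.
  by rewrite row_mxEr mxE eqxx.
have mg l : measurableV (fun z : 'cV[R]_(n + p) =>
    (usubmx z - g0 (dsubmx z)) l 0 : R).
  rewrite /measurableV; under eq_fun do rewrite mxE [X in _ + X]mxE.
  apply: measurable_funB; first exact: measurableV_usubmx.
  exact: (measurableV_dsubmx (h := fun y => g0 y l 0 : R) (measurable_g0 l)).
have mphi : measurableV (fun z : 'cV[R]_(n + p) =>
    (usubmx z - g0 (dsubmx z)) i 0 * (usubmx z - g0 (dsubmx z)) j 0 : R).
  by apply: measurable_funM; exact: mg.
split.
- exact: measurable_cst.
- apply: gintegrable_stdI => //; under eq_fun do rewrite joint_factor_resid SE.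
  have := @stdI_quad _ _ S (fun=> 1) (measurable_cst _).
  by under eq_fun do rewrite mulr1; apply => _; rewrite ler01 lexx.
- apply: gintegrable_stdI => //; [exact: measurable_cst|exact: stdI_cst].
move=> B mB; have mB1 := measurableV_indic mB.
have mBd := measurableV_dsubmx (h := \1_B : _ -> R) mB1.
have mpsi := measurableV_indic_y mB.
rewrite !gexp_stdE//; last 2 first.
- by apply: measurable_funM => //; exact: measurable_cst.
- exact: measurable_funM.
rewrite stdEZ; last exact: (stdI_01 mpsi (@indic_y01 B)).
under eq_fun do rewrite joint_factor_resid SE.
rewrite (stdE_quad (J := [pred b : 'I_(r + p) | (b < r)%N]) mpsi (@indic_y01 B)); last 2 first.
- move=> b s u /= br; rewrite /indic_y !joint_factor_y; congr (\1_B (_ + _ *m _)).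
  apply/colP => l; rewrite mxE scale_coordE [in RHS]mxE.
  by rewrite (_ : (_ == b) = false) ?mul1r//; apply/eqP => lb;
     move: br; rewrite -lb /= ltnNge leq_addr.
- move=> b c; rewrite mxE big_ord1 mxE mulf_eq0 negb_or => /andP[].
  by move=> /residr_l[b' ->] /residr_l[c' ->]; rewrite /= !ltn_ord.
congr (_%:E * _)%E.
rewrite mxtrace_mulC [residr j *m _]mx11_scalar mxtrace_scalar mulr1n.
rewrite /residr tr_row_mx mul_row_col mul0mx addr0 !mxE.
by apply: eq_bigr => a _; rewrite !mxE mulrC.
Qed.

End Posterior.

(** * Maximization of the Lagrangian *)

Section LogBounds.
Import numFieldNormedType.Exports.
Context {R : realType}.

Lemma ln_lt_subr1 (x : R) : 0 < x -> x != 1 -> ln x < x - 1.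
Proof.
move=> x0 x1; rewrite ltrBrDl -[ltRHS](lnK x0) expR_gt1Dx//.
by rewrite ln_eq0.
Qed.

Lemma ln_le_subr1 (x : R) : 0 < x -> ln x <= x - 1.
Proof.
by move=> x0; have [->|/(ln_lt_subr1 x0)/ltW//] := eqVneq x 1; rewrite ln1 subrr.
Qed.

(* Twice the divergence between centered normal laws on R, the variance of the
   second one being e times that of the first one. *)
Definition var_div (e : R) := e^-1 - 1 + ln e.

Lemma var_div1 : var_div 1 = 0.
Proof. by rewrite /var_div invr1 subrr ln1 addr0. Qed.

Lemma var_div_ge0 e : 0 < e -> 0 <= var_div e.
Proof.
move=> e0; have := ln_le_subr1 (x := e^-1); rewrite invr_gt0 => /(_ e0).
by rewrite lnV ?posrE// /var_div; lra.
Qed.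

Lemma var_div_decr e e' : 0 < e < e' -> e' <= 1 -> var_div e' < var_div e.
Proof.
move=> /andP[e0 ee'] e'1; have e'0 : 0 < e' := lt_trans e0 ee'.
have t1 : e' / e != 1 by apply/eqP => /(f_equal ( *%R^~ e)); rewrite divfK ?gt_eqF//; lra.
have := ln_lt_subr1 (divr_gt0 e'0 e0) t1; rewrite ln_div ?posrE// => lnt.
have ie : e'^-1 < e^-1 by rewrite ltf_pV2 ?posrE.
(* By ln t < t - 1 at t = e' / e, the difference [var_div e - var_div e'] exceeds this product. *)
have : 0 <= (1 - e') * (e^-1 - e'^-1) by rewrite mulr_ge0 ?subr_ge0// ltW.
rewrite mulrBr mulrBl [(1 - e') * e'^-1]mulrBl divff ?gt_eqF// !mul1r.
by rewrite /var_div; lra.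
Qed.

(** An explicit point replaces the limit at 0: with s = sqrt c, ln (1 + s) <= s gives (1 + s)^2 - 1
    - 2 ln (1 + s) >= s^2. *)
Lemma var_div_ge (c : R) : 0 <= c -> c <= var_div ((1 + Num.sqrt c) ^- 2).
Proof.
move=> c0; have s0 := sqrtr_ge0 c; have b0 : 0 < 1 + Num.sqrt c by lra.
rewrite /var_div invrK lnV ?posrE ?exprn_gt0// lnXn// mulr2n.
have := ln_le_subr1 b0; have := sqr_sqrtr c0; rewrite expr2 expr2.
move: (ln _) => l; nra.
Qed.

Section multiplier.
Variables (k : nat) (d : 'I_k -> R) (i0 : 'I_k).
Hypothesis d0 : forall i, 0 <= d i.
Hypothesis dmax : forall i, d i <= d i0.
Hypothesis di0 : 0 < d i0.

(* Divergence from the nominal model, as a function of x = 1 / lambda. *)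
Definition total_div (x : R) := 2^-1 * \sum_i var_div (1 - d i * x).

(** Every term is nondecreasing, terms with d_i = 0 being constant; strictness comes from i0. *)
Lemma total_div_incr x y : 0 < x < y -> d i0 * y < 1 -> total_div x < total_div y.
Proof.
move=> /andP[x0 xy] y1; rewrite ltr_pM2l ?invr_gt0//.
have dy1 i : d i * y < 1.
  by apply: le_lt_trans y1; rewrite ler_wpM2r ?dmax ?ltW// (lt_trans x0).
have term i : var_div (1 - d i * x) <= var_div (1 - d i * y).
  have [->|di] := eqVneq (d i) 0; first by rewrite !mul0r.
  have di_gt0 : 0 < d i by rewrite lt_neqAle eq_sym di d0.
  apply/ltW/var_div_decr; last by rewrite lerBlDr lerDl mulr_ge0 ?ltW.
  by rewrite subr_gt0 dy1 ltrD2l ltrN2 ltr_pM2l.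
rewrite (bigD1 i0)//= [ltRHS](bigD1 i0)//=; apply: ltr_leD; last exact: ler_sum.
apply: var_div_decr; last by rewrite lerBlDr lerDl mulr_ge0 ?ltW.
by rewrite subr_gt0 y1 ltrD2l ltrN2 ltr_pM2l.
Qed.

Lemma total_div_inj x y : 0 < x -> 0 < y -> d i0 * x < 1 -> d i0 * y < 1 ->
  total_div x = total_div y -> x = y.
Proof.
move=> x0 y0 x1 y1 xy; have [xy'|xy'|//] := ltgtP x y.
- by have := @total_div_incr x y; rewrite x0 xy' y1 xy ltxx => /(_ isT isT).
- by have := @total_div_incr y x; rewrite y0 xy' x1 xy ltxx => /(_ isT isT).
Qed.

Lemma continuous_var_div_affine (a x : R) : 0 < 1 - a * x ->
  {for x, continuous (fun x => var_div (1 - a * x))}.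
Proof.
move=> ax.
have ca : {for x, continuous (fun x : R => 1 - a * x)}.
  apply: continuousB; first exact: cst_continuous.
  by apply: continuousM; [exact: cst_continuous|exact: cvg_id].
apply: continuousD; last first.
  by apply: continuous_comp => //; exact: continuous_ln.
apply: continuousB; last exact: cst_continuous.
by apply: continuousV => //; rewrite gt_eqF.
Qed.

Lemma total_div_surj c : 0 < c -> exists x, [/\ 0 < x, d i0 * x < 1 & total_div x = c].
Proof.
(* At b = (1 - e) / d_i0 the term of index i0 is [var_div e], which alone reaches 2 c, the factor
   1/2 in [total_div] explaining the 2. The intermediate value theorem applies on [0, b]. *)
move=> c0; pose e := (1 + Num.sqrt (2 * c)) ^- 2.
have s0 : 0 < Num.sqrt (2 * c) by rewrite sqrtr_gt0 mulr_gt0.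
have e0 : 0 < e by rewrite invr_gt0 exprn_gt0//; lra.
have e1 : e < 1 by rewrite invf_lt1 ?exprn_gt0 ?exprn_egt1//; lra.
pose b := (1 - e) / d i0; have b0 : 0 < b by rewrite divr_gt0// subr_gt0.
have db : d i0 * b = 1 - e by rewrite /b mulrC divfK// gt_eqF.
have pos i x : x <= b -> 0 <= x -> 0 < 1 - d i * x.
  move=> xb x0; rewrite subr_gt0 (@le_lt_trans _ _ (d i0 * b))//; last by rewrite db; lra.
  by rewrite ler_pM.
have F0 : total_div 0 = 0.
  by rewrite /total_div big1 ?mulr0// => i _; rewrite mulr0 subr0 var_div1.
have Fb : c <= total_div b.
  have h := var_div_ge (c := 2 * c); have := h (ltW (mulr_gt0 (ltr0Sn _ 1) c0)).
  rewrite -/e => ce; rewrite /total_div (bigD1 i0)//= db opprB addrCA subrr addr0.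
  have : 0 <= \sum_(i < k | i != i0) var_div (1 - d i * b).
    by apply: sumr_ge0 => i _; apply: var_div_ge0; apply: pos => //; exact: ltW.
  move: (\sum_(i < k | _) _) => s; lra.
have [||x] := @IVT R total_div 0 b c (ltW b0).
- apply: continuous_in_subspaceT => x /[!inE]/=; rewrite in_itv /= => /andP[x0 xb].
  rewrite (_ : total_div = fun x => 2^-1 * \sum_i var_div (1 - d i * x))//.
  apply: (@cvgM _ _ _ _ (fun=> 2^-1) (fun x => \sum_i var_div (1 - d i * x))); first exact: cvg_cst.
  apply: cvg_big => [|i _]; first exact: (@add_continuous R^o).
  by apply: continuous_var_div_affine; exact: pos.
- by rewrite F0 ge_min ltW//= le_max Fb orbT.
rewrite in_itv /= => /andP[x0 xb] Fx; exists x; split => //.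
  rewrite lt_neqAle x0 andbT; apply/eqP => x00; move: Fx; rewrite -x00 F0; lra.
by have := pos i0 x xb x0; rewrite subr_gt0.
Qed.

End multiplier.

Lemma ln_prod (I : Type) (s : seq I) (f : I -> R) : (forall i, 0 < f i) ->
  ln (\prod_(i <- s) f i) = \sum_(i <- s) ln (f i).
Proof.
move=> f0; elim: s => [|i s IH]; first by rewrite !big_nil ln1.
by rewrite !big_cons lnM ?posrE ?IH// prodr_gt0.
Qed.

(** On the eigenvalues of X^T X this is the sum of the inequalities ln t <= t - 1, so equality
    forces all of them to be 1. *)
Lemma ln_det_le_trace k (X : 'M[R]_k) : X \in unitmx ->
  2 * ln `|\det X| <= \tr (X^T *m X) - k%:R /\
  (2 * ln `|\det X| = \tr (X^T *m X) - k%:R -> X^T *m X = 1%:M).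
Proof.
move=> uX; have pM : psdmx (X^T *m X) by rewrite -{2}[X]trmxK; exact: psdmx_gram.
have [U [d [U1 ME]]] := orthogonal_diag pM.1.
have d0 : forall i, 0 <= d 0 i.
  apply: psdmx_diag_ge0; have := psdmx_conj U pM.
  by rewrite ME !mulmxA U1 mul1mx -mulmxA U1 mulmx1.
have dX : 0 < `|\det X| by rewrite normr_gt0 -unitfE -unitmxE.
have detM : \det X ^+ 2 = \prod_i d 0 i.
  rewrite expr2 -{1}det_tr -det_mulmx ME !det_mulmx det_diag mulrAC -det_mulmx.
  by rewrite (mulmx1C U1) det1 mul1r.
have d_gt0 i : 0 < d 0 i.
  rewrite lt_neqAle d0 andbT eq_sym; apply: contraTneq dX => di.
  rewrite normr_gt0 -(sqrf_eq0 (\det X)) detM negbK.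
  by rewrite (bigD1 i)//= di mul0r.
have lnE : 2 * ln `|\det X| = \sum_i ln (d 0 i).
  by rewrite mulr_natl -lnXn// real_normK ?num_real// detM ln_prod.
have trE : \tr (X^T *m X) - k%:R = \sum_i (d 0 i - 1).
  rewrite ME -mulmxA mxtrace_mulC -mulmxA U1 mulmx1 mxtrace_diag.
  by rewrite big_split /= sumrN sumr_const card_ord.
rewrite lnE trE; split; first by apply: ler_sum => i _; exact: ln_le_subr1.
move=> /eqP; rewrite eq_sym -subr_eq0 -sumrB psumr_eq0 => [/allP eq0|i _].
  have d1 i : d 0 i = 1.
    apply/eqP; apply: contraT => di; have := ln_lt_subr1 (d_gt0 i) di.
    by have := eq0 i (mem_index_enum _); rewrite /= subr_eq0 => /eqP ->; rewrite ltxx.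
  have dE : d = const_mx 1 by apply/rowP => i; rewrite d1 mxE.
  by rewrite ME dE diag_const_mx mulmx1 (mulmx1C U1).
by rewrite subr_ge0 ln_le_subr1.
Qed.

End LogBounds.

(** * Parametrization of the densities with a given support *)

Section SameSupport.
Context {R : realType} (N k : nat) (m : 'cV[R]_N) (C : 'M[R]_(N, k)).
Hypothesis fC : row_full C.
Let f := Gauss m (C *m C^T).

Lemma mximageD n l (A : 'M[R]_(n, l)) u v : mximage A u -> mximage A v ->
  mximage A (u + v).
Proof. by move=> [a _ <-] [b _ <-]; exists (a + b) => //; rewrite mulmxDr. Qed.

Lemma mximageN n l (A : 'M[R]_(n, l)) u : mximage A u -> mximage A (- u).
Proof. by move=> [a _ <-]; exists (- a) => //; rewrite mulmxN. Qed.

Lemma gsupp_mean (g : @gauss R N) : gsupp g (gmean g).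
Proof. by exists 0; rewrite ?addr0//; exists 0 => //; rewrite mulmx0. Qed.

Lemma gsupp_sub (g g' : @gauss R N) : gsupp g = gsupp g' ->
  mximage (gcov g) `<=` mximage (gcov g').
Proof.
move=> gg' v vg; have : gsupp g (gmean g + v) by exists v.
have := gsupp_mean g; rewrite gg' => -[w wg' wE] [w' w'g' w'E].
have -> : v = w' - w.
  by apply: (addrI (gmean g)); rewrite -w'E -wE addrACA subrr addr0.
exact: mximageD w'g' (mximageN wg').
Qed.

(** Differences of points turn equality of the affine supports into equality of the images, and
    [psdmx_factor] then provides L, which is determined up to an orthogonal factor on the right. *)
Lemma same_supp_gaussP ft : same_supp_gauss f ft <->
  exists dl (L : 'M[R]_k), L \in unitmx /\
    ft = Gauss (m + C *m dl) (C *m L *m (C *m L)^T).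
Proof.
split=> [[pK eqs]|[dl [L [uL ->]]]].
  have KC : mximage (gcov ft) = mximage C.
    rewrite -(mximage_gram fC); apply/seteqP; split.
    - exact: (gsupp_sub eqs).
    - exact: (gsupp_sub (esym eqs)).
  have [L uL KE] := psdmx_factor fC pK KC.
  have := gsupp_mean ft; rewrite eqs => -[v [w _ <-] mE].
  exists (C^T *m w), L; split => //.
  by case: ft mE KE {eqs pK KC} => mt Kt /= <- ->; rewrite mulmxA.
split=> /=; first exact: psdmx_gram.
have KC : mximage (C *m L *m (C *m L)^T) = mximage (C *m C^T).
  by rewrite !mximage_gram ?mximage_mul_unit// row_full_mul_unit.
have dlK : mximage (C *m C^T) (C *m dl).
  by rewrite mximage_gram//; exists dl.
rewrite /gsupp /= KC; apply/seteqP; split => _ [v vK <-].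
- by exists (C *m dl + v); [exact: mximageD|rewrite addrA].
- exists (v - C *m dl); first exact: mximageD vK (mximageN dlK).
  by rewrite addrACA subrr addr0.
Qed.

End SameSupport.

Section Lagrangian.
Context {R : realType} (k : nat) (d : 'rV[R]_k) (lam : R).
Hypothesis lam0 : 0 < lam.
Hypothesis dlam : forall i, d 0 i < lam.

Let e i := 1 - d 0 i / lam.

Let e0 i : 0 < e i. Proof. by rewrite subr_gt0 ltr_pdivrMr// mul1r. Qed.

Definition opt_factor : 'M[R]_k :=
  diag_mx (\row_i (Num.sqrt (1 - d 0 i / lam))^-1).

Let root : 'M[R]_k := diag_mx (\row_i Num.sqrt (e i)).

Lemma opt_factor_unit : opt_factor \in unitmx.
Proof.
rewrite unitmxE det_diag unitfE; apply/prodf_neq0 => i _.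
by rewrite mxE invr_neq0// gt_eqF// sqrtr_gt0 e0.
Qed.

Let root_opt : root *m opt_factor = 1%:M.
Proof.
rewrite mulmx_diag -diag_const_mx; congr diag_mx; apply/rowP => i.
by rewrite !mxE divff// gt_eqF// sqrtr_gt0 e0.
Qed.

Let rootE : root^T *m root = 1%:M - lam^-1 *: diag_mx d.
Proof.
rewrite tr_diag_mx mulmx_diag; apply/matrixP => i j; rewrite !mxE.
case: eqP => [->|_]; last by rewrite !mulr0n mulr0 subrr.
by rewrite !mulr1n -expr2 sqr_sqrtr ?ltW// /e mulrC.
Qed.

Lemma opt_factor_gram : opt_factor *m opt_factor^T =
  diag_mx (\row_i (1 - d 0 i / lam)^-1).
Proof.
rewrite tr_diag_mx mulmx_diag; congr diag_mx; apply/rowP => i.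
by rewrite !mxE -invfM -expr2 sqr_sqrtr ?ltW// e0.
Qed.

Definition param_risk (dl : 'cV[R]_k) (L : 'M[R]_k) : R :=
  2^-1 * (quad (diag_mx d) dl + \tr (L^T *m diag_mx d *m L)).

Definition param_div (dl : 'cV[R]_k) (L : 'M[R]_k) : R :=
  2^-1 * (sqnorm dl + \tr (L *m L^T) - k%:R) - ln `|\det L|.

Let objE dl L : L \in unitmx ->
  param_risk dl L - lam * param_div dl L =
  lam * (- (2^-1 * sqnorm (root *m dl)) +
    2^-1 * (2 * ln `|\det (root *m L)| - (\tr ((root *m L)^T *m (root *m L)) - k%:R))
    - ln `|\det root|).
Proof.
move=> uL.
have ur : root \in unitmx by case: (mulmx1_unit root_opt).
have detE : ln `|\det (root *m L)| = ln `|\det root| + ln `|\det L|.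
  by rewrite det_mulmx normrM lnM// posrE normr_gt0 -unitfE -unitmxE.
have trE : \tr ((root *m L)^T *m (root *m L)) =
    \tr (L *m L^T) - lam^-1 * \tr (L^T *m diag_mx d *m L).
  rewrite trmx_mul mulmxA -[_ *m root^T *m _]mulmxA rootE mulmxBr mulmxBl mulmx1.
  by rewrite raddfB /= mxtrace_mulC -scalemxAr -scalemxAl mxtraceZ.
have nE : sqnorm (root *m dl) = sqnorm dl - lam^-1 * quad (diag_mx d) dl.
  rewrite -quad_gram rootE /quad mulmxBr mulmxBl mulmx1 -scalemxAr -scalemxAl.
  by rewrite [in LHS]mxE [X in _ + X]mxE [X in _ - X]mxE.
rewrite detE trE nE /param_risk /param_div.
move: (quad _ _) (\tr (_ *m diag_mx d *m _)) => a b.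
by field; exact: lt0r_neq0.
Qed.

(* Whitening L by the square root of 1 - S / lambda, with S = diag d, turns the
   Lagrangian into a multiple of ln det M - tr M for M = X^T X. *)
Lemma param_lagrangian_max dl L : L \in unitmx ->
  let obj dl L := param_risk dl L - lam * param_div dl L in
  obj dl L <= obj 0 opt_factor /\
  (obj dl L = obj 0 opt_factor -> dl = 0 /\ L *m L^T = opt_factor *m opt_factor^T).
Proof.
move=> uL obj.
have ur : root \in unitmx by case: (mulmx1_unit root_opt).
have uX : root *m L \in unitmx by rewrite unitmx_mul ur.
have [Xle Xeq] := ln_det_le_trace uX.
have -> : obj 0 opt_factor = lam * (- ln `|\det root|).
  rewrite /obj objE ?opt_factor_unit// root_opt det1 normr1 ln1 mulmx0.
  rewrite trmx1 mul1mx mxtrace1 subrr sqnormE big1 ?mulr0 ?oppr0 ?add0r ?subrr ?mulr0 ?add0r//.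
  by move=> i _; rewrite mxE expr0n.
rewrite /obj objE// ler_pM2l//.
have n0 := sqnorm_ge0 (root *m dl).
split; first lra.
move=> /(mulfI (lt0r_neq0 lam0)) eq.
have nz : sqnorm (root *m dl) = 0 by lra.
have XX : (root *m L)^T *m (root *m L) = 1%:M by apply: Xeq; lra.
split.
  by have := sqnorm_eq0 nz => /(f_equal (mulmx (invmx root))); rewrite mulKmx// mulmx0.
have LE : L = opt_factor *m (root *m L).
  by rewrite mulmxA (mulmx1C root_opt) mul1mx.
rewrite LE; move: XX; set X := root *m L => XX.
by rewrite trmx_mul mulmxA -[opt_factor *m X *m _]mulmxA (mulmx1C XX) mulmx1.
Qed.

Lemma param_div_opt : param_div 0 opt_factor = total_div (d 0) lam^-1.
Proof.
rewrite /param_div opt_factor_gram /total_div sqnormE big1 ?add0r; last first.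
  by move=> i _; rewrite mxE expr0n.
rewrite mxtrace_diag det_diag normr_prod ln_prod; last first.
  by move=> i; rewrite mxE normr_gt0 invr_neq0// gt_eqF// sqrtr_gt0 e0.
have -> : \sum_i ln `|(\row_i0 (Num.sqrt (1 - d 0 i0 / lam))^-1) 0 i| =
    - (2^-1 * \sum_i ln (1 - d 0 i / lam)).
  rewrite mulr_sumr -sumrN; apply: eq_bigr => i _.
  have s0 : 0 < Num.sqrt (1 - d 0 i / lam) by rewrite sqrtr_gt0 e0.
  rewrite mxE gtr0_norm ?invr_gt0// lnV ?posrE//.
  rewrite -{2}[1 - d 0 i / lam]sqr_sqrtr ?ltW ?e0// lnXn//; lra.
rewrite /var_div !big_split /= sumrN sumr_const card_ord.
under eq_bigr do rewrite mxE.
by rewrite opprK -mulrDr.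
Qed.

End Lagrangian.

(** * Factorization of the nominal model *)

Section Decomposition.
Context {R : realType}.

Lemma pdmx_psd N (A : 'M[R]_N) : pdmx A -> psdmx A.
Proof.
move=> [sA pA]; split => // v; have [->|v0] := eqVneq v 0; last exact/ltW/pA.
by rewrite /quad mulmx0 mxE.
Qed.

Lemma pdmx_unit N (A : 'M[R]_N) : pdmx A -> A \in unitmx.
Proof.
move=> [sA pA]; rewrite unitmxE unitfE; apply/negP => /det0P[v v0 vA].
have /pA : v^T != 0 by apply: contra v0 => /eqP v0; rewrite -[v]trmxK v0 trmx0.
by rewrite /quad trmxK vA mul0mx mxE ltxx.
Qed.

Lemma joint_factor_gram n p r (C1 : 'M[R]_(n, r)) (C2 : 'M[R]_p) (G : 'M[R]_(n, p)) :
  joint_factor C1 C2 G *m (joint_factor C1 C2 G)^T =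
  block_mx (C1 *m C1^T + G *m (C2 *m C2^T) *m G^T) (G *m (C2 *m C2^T))
           (C2 *m C2^T *m G^T) (C2 *m C2^T).
Proof.
rewrite tr_block_mx mulmx_block trmx0 !(mul0mx, mulmx0, add0r).
by rewrite trmx_mul !mulmxA.
Qed.

Section nominal.
Variables (n p : nat) (Kx : 'M[R]_n) (Kxy : 'M[R]_(n, p)) (Kyx : 'M[R]_(p, n))
  (Ky : 'M[R]_p).
Let Kz := block_mx Kx Kxy Kyx Ky.
Let G := Kxy *m invmx Ky.
Let P := Kx - Kxy *m invmx Ky *m Kyx.
Hypothesis pKz : psdmx Kz.
Hypothesis pKy : pdmx Ky.

Let uKy := pdmx_unit pKy.

Lemma cov_blocks : [/\ Kx^T = Kx, Kyx = Kxy^T, G *m Ky = Kxy & Ky *m G^T = Kyx].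
Proof.
have := pKz.1; rewrite /Kz tr_block_mx => /eq_block_mx[sx sxy syx sy].
split => //.
  by rewrite /G mulmxKV.
by rewrite /G trmx_mul trmx_inv sy mulmxA mulmxV// mul1mx syx.
Qed.

(** Block elimination of [Kxy], for an arbitrary posterior covariance X: it yields the positivity of
    X and, in the uniqueness of lambda, the comparison of images. *)
Lemma schur_congruence (X : 'M[R]_n) :
  row_mx 1%:M (- G) *m block_mx (X + G *m Kyx) Kxy Kyx Ky = row_mx X 0.
Proof.
have [_ _ GK _] := cov_blocks.
by rewrite mul_row_block !mul1mx !mulNmx GK subrr addrK.
Qed.

Lemma schur_psd (X : 'M[R]_n) :
  psdmx (block_mx (X + G *m Kyx) Kxy Kyx Ky) -> psdmx X.
Proof.
move=> /(psdmx_conj (row_mx 1%:M (- G))^T); rewrite trmxK schur_congruence.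
by rewrite tr_row_mx mul_row_col mul0mx addr0 trmx1 mulmx1.
Qed.

Lemma nominal_blocks : Kz = block_mx (P + G *m Kyx) Kxy Kyx Ky.
Proof. by rewrite /P subrK. Qed.

Lemma joint_factor_cov r (C1 : 'M[R]_(n, r)) (C2 : 'M[R]_p) :
  Ky = C2 *m C2^T ->
  block_mx (C1 *m C1^T + G *m Kyx) Kxy Kyx Ky =
  joint_factor C1 C2 G *m (joint_factor C1 C2 G)^T.
Proof.
have [_ _ GK KG] := cov_blocks.
by move=> KyE; rewrite joint_factor_gram -KyE KG -mulmxA KG GK.
Qed.

Lemma nominal_factor r q (H : 'M[R]_(q, n)) : \rank Kz = (r + p)%N ->
  exists (C1 : 'M[R]_(n, r)) (C2 : 'M[R]_p) (d : 'rV[R]_r),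
    [/\ row_full C1, C2 \in unitmx, P = C1 *m C1^T, Ky = C2 *m C2^T &
        (H *m C1)^T *m (H *m C1) = diag_mx d].
Proof.
move=> rk; have pP : psdmx P by apply: schur_psd; rewrite -nominal_blocks.
have [C2 KyE] := psdmx_sqrt (pdmx_psd pKy).
have uC2 : C2 \in unitmx by move: uKy; rewrite KyE unitmx_mul => /andP[].
have [C1' fC1' PE'] := psdmx_rank_factor pP erefl.
(* A factor of P with as many columns as its own rank gives a factorization of K_z of rank
   [\rank P + p]. *)
have rP : \rank P = r.
  apply: (@addIn p); rewrite -rk nominal_blocks {2}PE' (joint_factor_cov C1' KyE).
  have fC := joint_factor_full G fC1' uC2.
  by rewrite (mximage_rank (mximage_gram fC)) (eqP fC).
have [C1 fC1 PE] := psdmx_rank_factor pP rP.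
have pS : psdmx ((H *m C1)^T *m (H *m C1)).
  by rewrite -{2}[H *m C1]trmxK; exact: psdmx_gram.
have [U [d [U1 SE]]] := orthogonal_diag pS.1.
have uU : U \in unitmx by case: (mulmx1_unit U1).
(* The rotation U preserves C1 C1^T and diagonalizes the quadratic form of the error. *)
exists (C1 *m U), C2, d; split => //.
- exact: row_full_mul_unit.
- by rewrite trmx_mul mulmxA -[C1 *m U *m _]mulmxA (mulmx1C U1) mulmx1.
- rewrite [H *m (C1 *m U)]mulmxA [(_ *m U)^T]trmx_mul mulmxA.
  rewrite -[U^T *m _ *m (H *m C1)]mulmxA SE !mulmxA U1 mul1mx.
  by rewrite -mulmxA U1 mulmx1.
Qed.

End nominal.

Section Performance.
Variables (n r q : nat) (C1 : 'M[R]_(n, r)) (H : 'M[R]_(q, n)) (d : 'rV[R]_r).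
Hypothesis fC1 : row_full C1.
Hypothesis rH : \rank H = q.
Hypothesis HC : mximage H^T `<=` mximage (C1 *m C1^T).
Hypothesis HE : (H *m C1)^T *m (H *m C1) = diag_mx d.

Let P := C1 *m C1^T.

(** The rows of H lie in the image of C1, which the projector [C1 *m mpinv C1] fixes. This is how
    the inclusion of Im(H^T) in Im(P) enters. *)
Lemma perf_proj : H *m C1 *m mpinv C1 = H.
Proof.
have /mximage_subP[X HX] := HC.
have HE' : H = (C1^T *m X)^T *m C1^T by rewrite -trmx_mul mulmxA -HX trmxK.
have E : C1^T *m C1 *m mpinv C1 = C1^T.
  by rewrite -mulmxA -mpinv_proj_sym -trmx_mul -mulmxA mpinvK_full// mulmx1.
by rewrite {1}HE' -!mulmxA [C1^T *m (C1 *m _)]mulmxA E -HE'.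
Qed.

Lemma perf_quad_ge0 i : 0 <= d 0 i.
Proof.
by apply: psdmx_diag_ge0; rewrite -HE -{2}[H *m C1]trmxK; exact: psdmx_gram.
Qed.

Lemma perf_quad_gt0 : (0 < q)%N -> exists i, 0 < d 0 i.
Proof.
move=> q0; apply: contrapT => /forallNP dN.
have d0 : diag_mx d = 0.
  suff -> : d = 0 by rewrite linear0.
  apply/rowP => i; rewrite mxE; apply/eqP; rewrite eq_le perf_quad_ge0 andbT.
  by rewrite leNgt; apply/negP; exact: dN.
have HC0 : H *m C1 = 0.
  have Z (v : 'cV[R]_r) : H *m C1 *m v = 0.
    by apply: sqnorm_eq0; rewrite -quad_gram HE d0 /quad mulmx0 mul0mx mxE.
  apply/matrixP => i j; have := Z (delta_mx j 0).
  by rewrite -colE => /colP/(_ i); rewrite mxE => ->; rewrite !mxE.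
have H0 : H = 0 by rewrite -perf_proj HC0 mul0mx.
by move: q0; rewrite -rH H0 mxrank0.
Qed.

(** By [perf_proj], H^T H lies in the same sandwich as [mpinv P], so the outer pseudo-inverse
    reduces to inverting a diagonal matrix. *)
Lemma perf_mpinv (l : R) : mpinv P - l *: (H^T *m H) =
  (mpinv C1)^T *m (1%:M - l *: diag_mx d) *m mpinv C1.
Proof.
rewrite mpinv_gram// -[in LHS]perf_proj [(_ *m mpinv C1)^T]trmx_mul.
rewrite [X in _ - _ *: X]mulmxA -[_ *m (H *m C1)^T *m _]mulmxA HE.
by rewrite mulmxBr mulmxBl mulmx1 -scalemxAr -scalemxAl.
Qed.

Lemma perf_mpinv_opt lam : 0 < lam -> (forall i, d 0 i < lam) ->
  mpinv (mpinv P - lam^-1 *: (H^T *m H)) =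
  C1 *m opt_factor d lam *m (C1 *m opt_factor d lam)^T.
Proof.
move=> lam0 dlam; rewrite perf_mpinv.
have EE : (1%:M - lam^-1 *: diag_mx d) *m
    (opt_factor d lam *m (opt_factor d lam)^T) = 1%:M.
  rewrite opt_factor_gram// (_ : 1%:M - _ = diag_mx (\row_i (1 - d 0 i / lam))).
    rewrite mulmx_diag -diag_const_mx; congr diag_mx; apply/rowP => i.
    by rewrite !mxE divff// gt_eqF// subr_gt0 ltr_pdivrMr// mul1r.
  apply/matrixP => i j; rewrite !mxE.
  by case: eqP => [->|_]; rewrite ?mulr1n ?mulr0n ?mulr0 ?subrr// mulrC.
by rewrite (mpinv_sandwichV fC1 EE) trmx_mul !mulmxA.
Qed.

(* Q may be strictly smaller than H P H^T, so lambda > sigma_max Q does not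
   suffice here: it is the support of the density that forces d < lambda. *)
Lemma perf_mpinv_psd lam X : 0 < lam ->
  X = mpinv (mpinv P - lam^-1 *: (H^T *m H)) -> psdmx X ->
  mximage X = mximage C1 -> forall i, d 0 i < lam.
Proof.
move=> lam0 XE pX XC.
have [L uL XL] := psdmx_factor fC1 pX XC.
set E := 1%:M - lam^-1 *: diag_mx d.
have uM : L *m L^T \in unitmx by rewrite unitmx_mul unitmx_tr uL.
(* The two expressions of [mpinv X] are compared between C1^T and C1. The diagonal matrix E is then
   both invertible and positive semidefinite, hence has positive entries. *)
have ME : invmx (L *m L^T) = E.
  have : mpinv X = (mpinv C1)^T *m invmx (L *m L^T) *m mpinv C1.
    rewrite -(mpinv_sandwich fC1 (mulmxV uM)); congr mpinv.
    by rewrite XL trmx_mul !mulmxA.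
  rewrite XE mpinvK perf_mpinv -/E => /(f_equal (fun Y => C1^T *m Y *m C1)).
  rewrite !mulmxA -trmx_mul mpinvK_full// trmx1 !mul1mx -!mulmxA mpinvK_full//.
  by rewrite !mulmx1.
have EM : E *m (L *m L^T) = 1%:M by rewrite -ME mulVmx.
have EE : E = diag_mx (\row_i (1 - d 0 i / lam)).
  apply/matrixP => i j; rewrite !mxE.
  by case: eqP => [->|_]; rewrite ?mulr1n ?mulr0n ?mulr0 ?subrr// mulrC.
have sE : E^T = E by rewrite EE tr_diag_mx.
have pE : psdmx E.
  have -> : E = E *m L *m (E *m L)^T.
    by rewrite trmx_mul mulmxA -[E *m L *m _]mulmxA EM mul1mx sE.
  exact: psdmx_gram.
move=> i; rewrite -[ltRHS]mul1r -ltr_pdivrMr// -subr_gt0 lt_neqAle.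
move: (pE); rewrite EE => /psdmx_diag_ge0/(_ i); rewrite mxE => ->.
rewrite andbT eq_sym; apply/eqP => e0.
have : (E *m (L *m L^T)) i i = 1 by rewrite EM mxE eqxx.
by rewrite EE mul_diag_mx !mxE e0 mul0r => /esym/eqP; rewrite oner_eq0.
Qed.

Let Q := H *m H^T *m invmx (H *m mpinv P *m H^T) *m (H *m H^T).

(* With B = H C1 and D = C1^+ H^T, Q is B times the orthogonal projection onto
   the image of D times B^T, so its eigenvalues are at most those of B^T B. *)
Lemma sigma_max_bounds s : (0 < q)%N -> 0 < s -> (forall i, d 0 i <= s) ->
  0 < sigma_max Q <= s.
Proof.
move=> q0 s0 ds.
pose B := H *m C1; pose D := mpinv C1 *m H^T; pose M := D^T *m D.
have BD : B *m D = H *m H^T by rewrite /B /D mulmxA perf_proj.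
have ME : H *m mpinv P *m H^T = M.
  by rewrite mpinv_gram// /M /D trmx_mul trmxK !mulmxA.
have fHt : row_full H^T by rewrite /row_full mxrank_tr rH.
have uHH : H *m H^T \in unitmx by have := gram_unit fHt; rewrite trmxK.
have fD : row_full D.
  by apply/row_fullP; exists (invmx (H *m H^T) *m B); rewrite -mulmxA BD mulVmx.
have uM : M \in unitmx by exact: gram_unit.
clearbody D.
have sM : M^T = M by rewrite /M trmx_mul trmxK.
have sN : (invmx M)^T = invmx M by rewrite trmx_inv sM.
have sHH : (H *m H^T)^T = H *m H^T by rewrite trmx_mul trmxK.
have QE : Q = H *m H^T *m invmx M *m (H *m H^T) by rewrite /Q ME.
have sQ : Q^T = Q by rewrite QE trmx_mul sHH trmx_mul sN sHH mulmxA.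
have uQ : Q \in unitmx by rewrite QE !unitmx_mul uHH unitmx_inv uM.
have eig a : eigenvalue Q a -> 0 < a <= s.
  move=> /eigenvalueP[v vQ v0].
  (* This w satisfies |w|^2 = a |v|^2 and B w = a v, so |B w|^2 <= s |w|^2 reads a^2 <= s a. *)
  pose w := D *m invmx M *m (H *m H^T) *m v^T.
  have Qv : Q *m v^T = a *: v^T by rewrite -{1}sQ -trmx_mul vQ linearZ.
  have v0' : 0 < sqnorm v^T.
    by apply: sqnorm_gt0; apply: contra v0 => /eqP v0; rewrite -[v]trmxK v0 trmx0.
  have ww : sqnorm w = a * sqnorm v^T.
    rewrite -quad_gram.
    have -> : (D *m invmx M *m (H *m H^T))^T *m (D *m invmx M *m (H *m H^T)) = Q.
      rewrite QE; move: (H *m H^T) sHH => A sA.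
      rewrite trmx_mul sA trmx_mul sN -!mulmxA; congr (A *m (_ *m _)).
      by rewrite (mulmxA D^T D) -[D^T *m D]/M mulKVmx.
    by rewrite /quad -mulmxA Qv -scalemxAr mxE.
  have Bw : B *m w = a *: v^T.
    have assoc A : B *m (D *m invmx M *m A *m v^T) = B *m D *m invmx M *m A *m v^T.
      by rewrite !mulmxA.
    by rewrite /w assoc BD -QE Qv.
  have Bw_le : sqnorm (B *m w) <= s * sqnorm w.
    rewrite -quad_gram HE quad_diag sqnormE mulr_sumr; apply: ler_sum => i _.
    by rewrite ler_wpM2r ?sqr_ge0.
  have a_ge0 : 0 <= a by rewrite -(pmulr_lge0 _ v0') -ww sqnorm_ge0.
  have a0 : a != 0.
    apply: contraNneq v0 => a0; move: vQ; rewrite a0 scale0r.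
    by move=> /(f_equal (mulmx^~ (invmx Q))); rewrite mulmxK// mul0mx => ->.
  have a_gt0 : 0 < a by rewrite lt_neqAle eq_sym a0.
  rewrite a_gt0; move: Bw_le; rewrite Bw sqnormZ ww mulrA ler_pM2r//.
  by rewrite expr2 ler_pM2r.
have [a ea] := exists_real_eigenvalue q0 sQ.
have ub : ubound [set a | eigenvalue Q a] s by move=> b /= /eig/andP[].
apply/andP; split; last by apply: ge_sup => //; exists a.
have /andP[a0 _] := eig a ea; apply: (lt_le_trans a0).
by apply: ub_le_sup => //; exists s.
Qed.

End Performance.
End Decomposition.

(** * The minimax problem *)

Section NullTransfer.
Context {R : realType} (N k : nat) (m : 'cV[R]_N) (C : 'M[R]_(N, k)).
Hypothesis fC : row_full C.

Lemma gdens_gt0 z : 0 < gdens (Gauss m (C *m C^T)) z.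
Proof.
have -> : z = m + (z - m) by rewrite [m + _]addrC subrK.
rewrite gdens_gauss// mulr_gt0 ?expR_gt0// invr_gt0 sqrtr_gt0.
by rewrite mulr_gt0 ?exprn_gt0 ?twopi_gt0// pdet_gram_gt0.
Qed.

End NullTransfer.

Section NullTransfer2.
Context {R : realType} (N k : nat) (m : 'cV[R]_N) (C : 'M[R]_(N, k)).
Hypothesis fC : row_full C.
Let member dl (L : 'M[R]_k) := Gauss (m + C *m dl) (C *m L *m (C *m L)^T).

Lemma gexp_member dl L (h : 'cV[R]_N -> R) : L \in unitmx -> measurableV h ->
  measurableV (fun u => (h (m + C *m u) * gdens (member dl L) (m + C *m u))%:E) /\
  gexp (member dl L) h = ((Num.sqrt (\det (C^T *m C)))%:E *
    lint (fun u => (h (m + C *m u) * gdens (member dl L) (m + C *m u))%:E))%E.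
Proof.
move=> uL mh; have fCL := row_full_mul_unit fC uL.
have mhg : measurableV (fun z => (h z * gdens (member dl L) z)%:E).
  apply/measurable_EFinP; apply: measurable_funM => //.
  exact: measurableV_gdens.
split; first exact: (measurableV_chart m C mhg).
rewrite /gexp (gsupp_integral_chart (C := C) (m0 := m) (dl := dl))//.
by rewrite /= mximage_gram// mximage_mul_unit.
Qed.

(* All the densities with a given support are equivalent measures. *)
Lemma gexp_null_transfer dl1 L1 dl2 L2 (phi h1 h2 : 'cV[R]_N -> R) :
  L1 \in unitmx -> L2 \in unitmx ->
  measurableV phi -> measurableV h1 -> measurableV h2 ->
  (forall z, 0 <= phi z) -> (forall z, phi z = 0 -> h1 z = h2 z) ->
  gexp (member dl1 L1) phi = 0%E ->
  gexp (member dl2 L2) h1 = gexp (member dl2 L2) h2.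
Proof.
move=> uL1 uL2 mphi mh1 mh2 phi0 phih.
have [mp ->] := gexp_member dl1 uL1 mphi.
have [m1 ->] := gexp_member dl2 uL2 mh1.
have [m2 ->] := gexp_member dl2 uL2 mh2.
have c0 : 0 < Num.sqrt (\det (C^T *m C)) by rewrite sqrtr_gt0 det_gram_gt0.
have g0 z : 0 < gdens (member dl1 L1) z.
  by apply: gdens_gt0; exact: row_full_mul_unit.
move=> /eqP; rewrite mule_eq0 eqe gt_eqF//= => /eqP I0.
congr (_ * _)%E; apply: ae_eq_integral => //.
have : (\int[lebesgue k]_t
    `|(phi (m + C *m colt t) * gdens (member dl1 L1) (m + C *m colt t))%:E| = 0)%E.
  rewrite -I0; apply: eq_integral => t _; rewrite gee0_abs// lee_fin.
  by rewrite mulr_ge0// ltW.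
move=> /(ae_eq_integral_abs (lebesgue k) measurableT mp).
apply: filterS => t /= /(_ Logic.I) [] /eqP; rewrite mulf_eq0 (gt_eqF (g0 _)) orbF => /eqP z0 _.
by rewrite phih.
Qed.

End NullTransfer2.

Section RobustProblem.
Context {R : realType} (n p q r : nat).
Variables (mx : 'cV[R]_n) (my : 'cV[R]_p) (C1 : 'M[R]_(n, r)) (C2 : 'M[R]_p)
  (G : 'M[R]_(n, p)) (H : 'M[R]_(q, n)) (d : 'rV[R]_r).
Hypothesis fC1 : row_full C1.
Hypothesis uC2 : C2 \in unitmx.
Hypothesis HE : (H *m C1)^T *m (H *m C1) = diag_mx d.

Let C := joint_factor C1 C2 G.
Let mz := col_mx mx my.
Let f := Gauss mz (C *m C^T).
Let g0 (y : 'cV[R]_p) := G *m (y - my) + mx.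
(** The error of g0 does not involve u_y, hence the zero weights. *)
Let df : 'rV[R]_(r + p) := row_mx d 0.
Let member dl (L : 'M[R]_(r + p)) := Gauss (mz + C *m dl) (C *m L *m (C *m L)^T).

Let fC : row_full C. Proof. exact: joint_factor_full. Qed.

Let A : 'M[R]_(q, n + p) := H *m row_mx 1%:M (- G).

Let AC : A *m C = row_mx (H *m C1) 0.
Proof.
rewrite /A /C /joint_factor -mulmxA mul_row_block !mul1mx mulmx0 addr0.
by rewrite mulNmx subrr mul_mx_row mulmx0.
Qed.

Let ACg : (A *m C)^T *m (A *m C) = diag_mx df.
Proof.
rewrite AC tr_row_mx mul_col_row HE !trmx0 mul0mx mulmx0 mulmx0 /df diag_mx_row.
by congr block_mx; apply/matrixP => i j; rewrite !mxE mul0rn.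
Qed.

Lemma risk_member dl L : L \in unitmx ->
  risk H (member dl L) g0 = (param_risk df dl L)%:E.
Proof.
move=> uL; rewrite /risk /mse.
rewrite (_ : (fun z => sqnorm (H *m _)) = fun z => sqnorm (A *m (z - mz))).
  rewrite gexp_sqnorm// -EFinM /param_risk; congr EFin; congr (_ * _).
  congr (_ + _).
    by rewrite -quad_gram ACg.
  move: (A *m C) ACg => B BE; congr (\tr _).
  by rewrite trmx_mul !mulmxA -[L^T *m B^T *m B]mulmxA BE.
apply/funext => z; rewrite /A -mulmxA; congr (sqnorm (H *m _)).
rewrite -{3}[z]vsubmxK /mz opp_col_mx add_col_mx mul_row_col mul1mx /g0 mulNmx.
by rewrite opprD addrA addrAC.
Qed.

Lemma KL_member dl L : L \in unitmx -> KL (member dl L) f = (param_div dl L)%:E.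
Proof. by move=> uL; rewrite KL_gauss. Qed.

Variables (lam c : R).
Hypothesis lam0 : 0 < lam.
Hypothesis dlam : forall i, d 0 i < lam.
Hypothesis c0 : 0 < c.

Let dflam i : df 0 i < lam.
Proof.
rewrite /df; case: (fintype.splitP i) => j ij.
  by have -> : i = lshift p j by [exact: val_inj]; rewrite row_mxEl.
by have -> : i = rshift r j by [exact: val_inj]; rewrite row_mxEr mxE.
Qed.

Let L0 := opt_factor df lam.
Let uL0 : L0 \in unitmx. Proof. exact: opt_factor_unit. Qed.

Definition worst_density := Gauss mz (C *m L0 *m (C *m L0)^T).
Let f0 := worst_density.

Let f0E : f0 = member 0 L0.
Proof. by rewrite /member mulmx0 addr0. Qed.

Lemma same_supp_worst : same_supp_gauss f f0.
Proof. by apply/(same_supp_gaussP mz fC); exists 0, L0; rewrite -/(member 0 L0) -f0E. Qed.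

Lemma lagrangian_member dl L : L \in unitmx ->
  lagrangian H f c g0 lam (member dl L) =
  (param_risk df dl L - lam * param_div dl L + lam * c)%:E.
Proof.
move=> uL; rewrite /lagrangian risk_member// KL_member// -EFinB -EFinM -EFinD.
congr EFin; ring.
Qed.

Lemma lagrangian_max ft : same_supp_gauss f ft ->
  (lagrangian H f c g0 lam ft <= lagrangian H f c g0 lam f0)%E /\
  (lagrangian H f c g0 lam ft = lagrangian H f c g0 lam f0 -> ft = f0).
Proof.
move=> /(same_supp_gaussP mz fC)[dl [L [uL ->]]]; rewrite -/(member dl L).
have [le eq] := param_lagrangian_max lam0 dflam dl uL.
rewrite [in X in (_ <= X)%E]f0E [in X in _ = X -> _]f0E !lagrangian_member//.
rewrite lee_fin lerD2r; split => // -[/addIr/eq[-> LL]].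
rewrite f0E /member; congr (Gauss _ _).
by rewrite !trmx_mul !mulmxA -[C *m L *m _]mulmxA LL !mulmxA.
Qed.

Hypothesis cE : total_div (df 0) lam^-1 = c.

Lemma KL_worst : KL f0 f = c%:E.
Proof. by rewrite f0E KL_member// (param_div_opt lam0 dflam) cE. Qed.

Lemma worst_in_ball : KL_ball f c f0.
Proof. by split; [exact: same_supp_worst|rewrite KL_worst]. Qed.

Lemma lagrangian_worst : lagrangian H f c g0 lam f0 = risk H f0 g0.
Proof. by rewrite /lagrangian KL_worst subee// mule0 adde0. Qed.

Lemma risk_worst_fin : risk H f0 g0 \is a fin_num.
Proof. by rewrite f0E risk_member. Qed.

Lemma risk_le_lagrangian ft : KL_ball f c ft ->
  (risk H ft g0 <= lagrangian H f c g0 lam ft)%E.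
Proof.
move=> [/(same_supp_gaussP mz fC)[dl [L [uL ->]]]]; rewrite -/(member dl L).
rewrite lagrangian_member// risk_member// KL_member// !lee_fin => h.
rewrite -addrA lerDl addrC -mulrBr mulr_ge0 ?subr_ge0//; exact: ltW.
Qed.

Lemma risk_le_worst ft : KL_ball f c ft -> (risk H ft g0 <= risk H f0 g0)%E.
Proof.
move=> fB; rewrite -lagrangian_worst (le_trans (risk_le_lagrangian fB))//.
by have [] := lagrangian_max fB.1.
Qed.

(** The optimal factor is the identity on u_y, so the least favorable density has the structure of
    the nominal one with only C1 changed. All results on the posterior law therefore apply to it
    with the same g0. *)
Lemma worst_factor : C *m L0 = joint_factor (C1 *m opt_factor d lam) C2 G.
Proof.
have -> : L0 = block_mx (opt_factor d lam) 0 0 1%:M.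
  rewrite /L0 /opt_factor -diag_const_mx -diag_mx_row; congr diag_mx.
  apply/rowP => i; rewrite /df; case: (fintype.splitP i) => j ij.
    have -> : i = lshift p j by exact: val_inj.
    by rewrite mxE !row_mxEl mxE.
  have -> : i = rshift r j by exact: val_inj.
  by rewrite mxE !row_mxEr !mxE mul0r subr0 sqrtr1 invr1.
by rewrite mulmx_block !mulmx0 mul0mx !mulmx1 !addr0 !add0r.
Qed.

Let fC1o : row_full (C1 *m opt_factor d lam).
Proof. by apply: row_full_mul_unit => //; exact: opt_factor_unit. Qed.

Lemma mse_worst g : cV_measurable_fun g ->
  mse H f0 g = (mse H f0 g0 +
    gexp f0 (fun z => sqnorm (H *m (g (dsubmx z) - g0 (dsubmx z)))))%E.
Proof.
move=> mg; rewrite /f0 /worst_density worst_factor.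
exact: (mse_decomposition mx my G fC1o uC2 H mg).
Qed.

Lemma discrepancy_ge0 g :
  (0 <= gexp f0 (fun z => sqnorm (H *m (g (dsubmx z) - g0 (dsubmx z)))))%E.
Proof.
apply: mule_ge0; first by rewrite lee_fin sqrtr_ge0.
apply: integral_ge0 => t _; rewrite lee_fin mulr_ge0 ?sqnorm_ge0//.
by rewrite mulr_ge0 ?expR_ge0// invr_ge0 sqrtr_ge0.
Qed.

Lemma risk_worst_ge g : cV_measurable_fun g -> (risk H f0 g0 <= risk H f0 g)%E.
Proof.
move=> mg; rewrite /risk lee_pmul2l ?lte_fin// (mse_worst mg) leeDl//.
exact: discrepancy_ge0.
Qed.

Lemma bayes_worst : bayes_estimator H f0 g0.
Proof.
split; last exact: risk_worst_ge.
by rewrite /f0 /worst_density worst_factor; exact: gauss_posterior_mean.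
Qed.

Lemma posterior_cov_worst :
  posterior_cov f0 g0 (C1 *m opt_factor d lam *m (C1 *m opt_factor d lam)^T).
Proof. by rewrite /f0 /worst_density worst_factor; exact: gauss_posterior_cov. Qed.

Lemma g0_estimator : estimators H f c g0.
Proof.
split; first exact: measurable_g0.
exists (2 * param_risk df 0 L0) => ft /risk_le_worst.
rewrite f0E risk_member// /risk => h.
rewrite EFinM -[leLHS](_ : (2%:E * ((2^-1)%:E * mse H ft g0) = _)%E).
  by rewrite lee_pmul2l ?lte_fin.
by rewrite muleA -EFinM divff// mul1e.
Qed.

Lemma worst_risk_g0 : worst_risk H f c g0 = risk H f0 g0.
Proof.
apply/eqP; rewrite eq_le; apply/andP; split.
  by apply: ub_ereal_sup => _ [ft fB <-]; exact: risk_le_worst.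
by apply: ereal_sup_ubound; exists f0 => //; exact: worst_in_ball.
Qed.

Lemma minimax_worst : minimax_solution H f c f0 g0.
Proof.
split; [exact: g0_estimator| |exact: worst_in_ball|exact: risk_le_worst].
move=> g [mg _]; rewrite worst_risk_g0 (le_trans (risk_worst_ge mg))//.
by apply: ereal_sup_ubound; exists f0 => //; exact: worst_in_ball.
Qed.

(** Optimality of g makes its risk under f0 at most that of g0, which cancels the discrepancy term.
    Then g and g0 have equal risks under [ft] and f0, so [ft] attains the maximum of the Lagrangian
    for g0, whose maximizer is unique. *)
Lemma minimax_unique ft g : minimax_solution H f c ft g ->
  ft = f0 /\
  gexp f0 (fun z => sqnorm (H *m (g (dsubmx z) - g0 (dsubmx z)))) = 0%E.
Proof.
move=> [[mg _] gmin ftB ftmax].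
have D0 : gexp f0 (fun z => sqnorm (H *m (g (dsubmx z) - g0 (dsubmx z)))) = 0%E.
  apply/eqP; rewrite eq_le discrepancy_ge0 andbT.
  have : (risk H f0 g <= risk H f0 g0)%E.
    rewrite -worst_risk_g0 (le_trans _ (gmin _ g0_estimator))//.
    by apply: ereal_sup_ubound; exists f0 => //; exact: worst_in_ball.
  have mfin : mse H f0 g0 \is a fin_num.
    move: risk_worst_fin; rewrite /risk; case: (mse _ _ _) => //.
    - by rewrite gt0_muley ?lte_fin.
    - by rewrite gt0_muleNy ?lte_fin.
  rewrite /risk lee_pmul2l ?lte_fin// (mse_worst mg).
  by rewrite -[leRHS]adde0 leeD2lE.
split => //.
have mD := measurableV_discrepancy mx my G H mg.
have mE := measurableV_error H mg; have mE0 := measurableV_error H (measurable_g0 mx my G).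
(* [ft] is least favorable for g, while the Lagrangian is written for g0; equality of null sets
   bridges the two. *)
have ftE : risk H ft g = risk H ft g0.
  have [dl [L [uL ->]]] := (same_supp_gaussP mz fC ft).1 ftB.1.
  rewrite /risk /mse; congr (_ * _)%E.
  move: D0; rewrite f0E; apply: gexp_null_transfer => // [z|z /sqnorm_eq0 Hz].
    exact: sqnorm_ge0.
  have -> : usubmx z - g (dsubmx z) =
      usubmx z - g0 (dsubmx z) - (g (dsubmx z) - g0 (dsubmx z)).
    by rewrite opprB addrA subrK.
  by rewrite mulmxBr Hz subr0.
have f0g : risk H f0 g = risk H f0 g0 by rewrite /risk (mse_worst mg) D0 adde0.
have [lmax leq] := lagrangian_max ftB.1.
apply: leq; apply/eqP; rewrite eq_le lmax /= lagrangian_worst.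
by rewrite -f0g (le_trans (ftmax _ worst_in_ball))// ftE risk_le_lagrangian.
Qed.

End RobustProblem.

Theorem theorem1 (R : realType) (n p q r : nat)
    (mx : 'cV[R]_n) (my : 'cV[R]_p)
    (Kx : 'M[R]_n) (Kxy : 'M[R]_(n, p)) (Kyx : 'M[R]_(p, n)) (Ky : 'M[R]_p)
    (H : 'M[R]_(q, n)) (c : R) :
  let mz := col_mx mx my in
  let Kz := block_mx Kx Kxy Kyx Ky in
  let f := Gauss mz Kz in
  let P := Kx - Kxy *m invmx Ky *m Kyx in
  let Q := H *m H^T *m invmx (H *m mpinv P *m H^T) *m (H *m H^T) in
  let G0 := Kxy *m invmx Ky in
  let g0 := fun y : 'cV[R]_p => G0 *m (y - my) + mx in
  let Pof := fun lambda : R => mpinv (mpinv P - lambda^-1 *: (H^T *m H)) in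
  let fof := fun lambda : R =>
    Gauss mz
      (block_mx (Pof lambda + Kxy *m invmx Ky *m Kyx) Kxy Kyx Ky) in
  psdmx Kz -> \rank Kz = (r + p)%N -> (r <= n)%N -> pdmx Ky ->
  (0 < q <= r)%N -> \rank H = q -> mximage H^T `<=` mximage P ->
  0 < c ->
  exists (lambda : R) (Kxt : 'M[R]_n),
    let f0 := Gauss mz (block_mx Kxt Kxy Kyx Ky) in
    let Pt := Kxt - Kxy *m invmx Ky *m Kyx in
    [/\ minimax_solution H f c f0 g0 /\
        (forall ft g, minimax_solution H f c ft g ->
           ft = f0 /\
           gexp f0 (fun z => sqnorm (H *m (g (dsubmx z) - g0 (dsubmx z))))
             = 0%E),
        bayes_estimator H f0 g0,
        [/\ posterior_cov f g0 P, posterior_cov f0 g0 Pt & Pt = Pof lambda],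
        [/\ 0 < sigma_max Q, sigma_max Q < lambda, KL f0 f = c%:E &
          forall ft, same_supp_gauss f ft ->
            (lagrangian H f c g0 lambda ft <= lagrangian H f c g0 lambda f0)%E] &
        forall lambda' : R, sigma_max Q < lambda' ->
          same_supp_gauss f (fof lambda') -> KL (fof lambda') f = c%:E ->
          lambda' = lambda].
Proof.
move=> mz Kz f P Q G0 g0 Pof fof pK rK _ pKy /andP[q0 _] rH HP c0.
have [C1 [C2 [d [fC1 uC2 PE KyE HE]]]] := nominal_factor pK pKy H rK.
rewrite -/P in PE.
have HC : mximage H^T `<=` mximage (C1 *m C1^T) by rewrite -PE.
have cov_factor (D1 : 'M[R]_(n, r)) :
    block_mx (D1 *m D1^T + Kxy *m invmx Ky *m Kyx) Kxy Kyx Ky =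
    joint_factor D1 C2 G0 *m (joint_factor D1 C2 G0)^T.
  exact: (joint_factor_cov pK pKy D1 KyE).
have fE : f = Gauss mz (joint_factor C1 C2 G0 *m (joint_factor C1 C2 G0)^T).
  by rewrite -cov_factor -PE /P subrK.
pose fw l := worst_density mx my C1 C2 G0 d l.
have fwE l : fw l = Gauss mz (block_mx
    (C1 *m opt_factor d l *m (C1 *m opt_factor d l)^T +
      Kxy *m invmx Ky *m Kyx) Kxy Kyx Ky).
  by rewrite cov_factor /fw /worst_density worst_factor.
have d0 := perf_quad_ge0 HE.
have [i1 di1] := perf_quad_gt0 fC1 rH HC HE q0.
have [i0 dmax] : exists i0, forall i, d 0 i <= d 0 i0.
  by exists [arg max_(i > i1) d 0 i]%O; case: Order.TotalTheory.arg_maxP => // i _ h j; exact: h.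
have di0 : 0 < d 0 i0 := lt_le_trans di1 (dmax i1).
pose df : 'rV[R]_(r + p) := row_mx d 0; pose j0 := lshift p i0.
have dfj0 : df 0 j0 = d 0 i0 by rewrite row_mxEl.
have dfP j : 0 <= df 0 j <= df 0 j0.
  rewrite dfj0 /df; case: (fintype.splitP j) => k jk.
    by have -> : j = lshift p k by [exact: val_inj]; rewrite row_mxEl d0 dmax.
  by have -> : j = rshift r k by [exact: val_inj]; rewrite row_mxEr mxE lexx ltW.
have df0 j : 0 <= df 0 j by case/andP: (dfP j).
have dfmax j : df 0 j <= df 0 j0 by case/andP: (dfP j).
have dfj0_gt0 : 0 < df 0 j0 by rewrite dfj0.
have [x [x0 xd xF]] := total_div_surj df0 dfmax dfj0_gt0 c0.
pose lam := x^-1; have lam0 : 0 < lam by rewrite invr_gt0.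
have dlam0 : d 0 i0 < lam by rewrite -dfj0 -[lam]mul1r ltr_pdivlMr.
have dlam i : d 0 i < lam := le_lt_trans (dmax i) dlam0.
have lamE : total_div (df 0) lam^-1 = c by rewrite invrK.
have /andP[Q0 Qle] := sigma_max_bounds fC1 rH HC HE q0 di0 dmax.
rewrite -PE -/Q in Q0 Qle.
exists lam, (C1 *m opt_factor d lam *m (C1 *m opt_factor d lam)^T +
      Kxy *m invmx Ky *m Kyx) => f0 Pt.
have f0E : f0 = fw lam by rewrite fwE.
have PtE : Pt = C1 *m opt_factor d lam *m (C1 *m opt_factor d lam)^T.
  by rewrite /Pt addrK.
split.
- rewrite fE f0E; split.
    exact: (minimax_worst mx my G0 fC1 uC2 HE lam0 dlam lamE).
  by move=> ft g; exact: (minimax_unique fC1 uC2 HE lam0 dlam lamE).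
- by rewrite f0E; exact: bayes_worst.
- split.
  + by rewrite fE PE; exact: gauss_posterior_cov.
  + by rewrite f0E PtE; exact: posterior_cov_worst.
  + by rewrite PtE /Pof PE (perf_mpinv_opt fC1 HC HE lam0 dlam).
- split => //; first exact: le_lt_trans dlam0.
  + by rewrite fE f0E; exact: (KL_worst mx my G0 fC1 uC2 lam0 dlam lamE).
  + move=> ft; rewrite fE f0E => /(lagrangian_max fC1 uC2 HE c lam0 dlam).
    by case.
- move=> l Ql; rewrite fE => -[pcov supp] KLc.
  have l0 : 0 < l := lt_trans Q0 Ql.
  have pX : psdmx (Pof l) := schur_psd pK pKy pcov.
  (* Multiplying by [1, -G0] carries an inclusion between images of joint covariances to the
     posterior covariances. *)
  have row_sub (X Y : 'M[R]_n) :
      mximage (block_mx (X + G0 *m Kyx) Kxy Kyx Ky) `<=`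
        mximage (block_mx (Y + G0 *m Kyx) Kxy Kyx Ky) -> mximage X `<=` mximage Y.
    move=> /mximage_subP[Z XZ]; apply/mximage_subP; exists (lsubmx (usubmx Z)).
    have := schur_congruence pK pKy X; rewrite XZ mulmxA (schur_congruence pK pKy).
    rewrite -{1}[Z]vsubmxK mul_row_col mul0mx addr0 => /(f_equal lsubmx).
    by rewrite row_mxKl -{1}[usubmx Z]hsubmxK mul_mx_row row_mxKl => ->.
  have XC : mximage (Pof l) = mximage C1.
    rewrite -(mximage_gram fC1); apply/seteqP; split; apply: row_sub.
    - by have := gsupp_sub supp; rewrite -cov_factor.
    - by have := gsupp_sub (esym supp); rewrite -cov_factor.
  have XE : Pof l = mpinv (mpinv (C1 *m C1^T) - l^-1 *: (H^T *m H)).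
    by rewrite /Pof PE.
  have dl := perf_mpinv_psd fC1 HC HE l0 XE pX XC.
  have fofE : fof l = fw l.
    by rewrite fwE /fof XE (perf_mpinv_opt fC1 HC HE l0 dl).
  (* Here the tolerance of [KL_worst] is taken to be the total divergence at 1 / l, so that the
     injectivity of [total_div] identifies l. *)
  have := KL_worst mx my G0 fC1 uC2 l0 dl erefl.
  rewrite -/(fw l) -fofE KLc => -[] /esym; rewrite -xF.
  move=> /(total_div_inj df0 dfmax dfj0_gt0) h.
  by rewrite -[l]invrK h ?invr_gt0// dfj0 ltr_pdivrMr ?mul1r.
Qed.
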